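(* There exist numerical constants $c_0,c_1,c_2>0$ such that for every positive integer $\ell$ the following holds. Let $G=G^{(n)}$ be a uniform random recursive $\ell$-dag on $n$ vertices, $n\in\mathbb{N}$. Then root estimation is possible in $G$ (i.e. for the sequence $\{G^{(n)}\}_{n\ge 1}$). Moreover, the confidence set sizes $K(\epsilon)$ in the definition of root estimation may be chosen so that, whenever $0<\epsilon\le e^{-c_2\ell}$, \[ K(\epsilon)\le \frac{c_0}{\epsilon}\,\bigl(\log(1/\epsilon)\bigr)^{\frac{c_1}{\ell}\log(1/\epsilon)} . \]
   Context: Write $[n]=\{1,\dots,n\}$. Uniform random recursive tree on $[n]$: the random tree in which, independently for each $i\in\{2,3,\dots,n\}$, vertex $i$ is attached by an (undirected) edge to a vertex chosen uniformly at random from $\{1,\dots,i-1\}$. Uniform random recursive $\ell$-dag on $n$ vertices: let $G_j=([n],E_j)$, $j\in[\ell]$, be independent uniform random recursive trees on $[n]$. The uniform random recursive $\ell$-dag is the simple undirected graph $G=([n],E_1\cup\cdots\cup E_\ell)$ (multiple edges are collapsed). Root estimation: let $\{G^{(n)}\}_{n\ge1}$ be a sequence of random graphs such that $G^{(n)}$ has vertex set $[n]$. Root estimation is possible if for every $\epsilon\in(0,1)$ there is a positive integer $K(\epsilon)$, not depending on $n$, such that for every $n\in\mathbb{N}$, upon observing $G^{(n)}$ without its vertex labels, one may find a set $S\subset[n]$ of at most $K(\epsilon)$ vertices with $\mathbb{P}\{1\in S\}\ge 1-\epsilon$. Here ''observing the graph without the vertex labels'' means that $S=S(G^{(n)})$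 for a rule $S(\cdot)$ (which may depend on $n$, $\epsilon$ and the model parameters) that assigns to each graph $H$ on $[n]$ a subset $S(H)\subset[n]$ and does not depend on the labeling: $S(\pi H)=\pi(S(H))$ for every permutation $\pi$ of $[n]$, where $\pi H$ is the graph obtained from $H$ by relabeling its vertices by $\pi$. *)

(* Defs.v *)
From HB Require Import structures.
From mathcomp Require Import all_boot all_order all_algebra all_fingroup.
From mathcomp Require Import reals.
Set Implicit Arguments.
Unset Strict Implicit.
Unset Printing Implicit Defensive.
Import Order.TTheory GRing.Theory Num.Theory.
Local Open Scope ring_scope.

Record sgraph (n : nat) := SGraph {
  edges : {set {set 'I_n}};
  _ : [forall e in edges, #|e| == 2] }.

HB.instance Definition _ n := [isSub for @edges n].
HB.instance Definition _ n := [Finite of sgraph n by <:].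

Fact relabel_subproof n (pi : {perm 'I_n}) (H : sgraph n) :
  [forall e in [set pi @: e | e : {set 'I_n} in edges H], #|e| == 2].
Proof.
apply/forall_inP => _ /imsetP[e eH ->].
by rewrite (card_imset _ (@perm_inj _ pi)); apply: (forall_inP (valP H)).
Qed.

Definition relabel n (pi : {perm 'I_n}) (H : sgraph n) : sgraph n :=
  SGraph (relabel_subproof pi H).

Fact gunion_subproof n l (T : {ffun 'I_l -> sgraph n}) :
  [forall e in \bigcup_(j < l) edges (T j), #|e| == 2].
Proof.
apply/forall_inP => e /bigcupP[j _ eT].
exact: (forall_inP (valP (T j))).
Qed.

Definition gunion n l (T : {ffun 'I_l -> sgraph n}) : sgraph n :=
  SGraph (gunion_subproof T).

(* A random graph is given by its probability mass function. Vertices are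
   numbered from 0, so that the root is ord0. There is at least one vertex: the
   member of index n of a sequence of random graphs has n.+1 vertices. *)

Section RandomGraphs.
Variable R : realType.

(* f i is the vertex to which the non-root vertex lift ord0 i (of value i.+1)
   is attached; it is uniform on the i.+1 vertices of value at most i,
   independently for each i. *)
Definition attach_pmf n (f : {ffun 'I_n -> 'I_n.+1}) : R :=
  \prod_(i < n) ((f i <= i)%N%:R / i.+1%:R).

Definition attach_edges n (f : {ffun 'I_n -> 'I_n.+1}) : {set {set 'I_n.+1}} :=
  [set [set lift ord0 i; f i] | i : 'I_n].

(* The f for which attach_edges f contains a loop have mass 0. *)
Definition recursive_tree_pmf n (T : sgraph n.+1) : R :=
  \sum_(f : {ffun 'I_n -> 'I_n.+1} | attach_edges f == edges T) attach_pmf f.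

Definition recursive_dag_pmf (l n : nat) (G : sgraph n.+1) : R :=
  \sum_(T : {ffun 'I_l -> sgraph n.+1} | gunion T == G)
    \prod_(j < l) recursive_tree_pmf (T j).

(* The rule S only sees the graph up to relabeling: it is equivariant. *)
Definition label_free n (S : sgraph n -> {set 'I_n}) : Prop :=
  forall (pi : {perm 'I_n}) (H : sgraph n), S (relabel pi H) = pi @: S H.

Definition confidence_size (mu : forall n, sgraph n.+1 -> R) (eps : R)
    (K : nat) : Prop :=
  (0 < K)%N /\
  forall n, exists S : sgraph n.+1 -> {set 'I_n.+1},
    [/\ label_free S,
        forall H, (#|S H| <= K)%N &
        1 - eps <= \sum_(H | ord0 \in S H) mu n H].

Definition root_estimation_possible (mu : forall n, sgraph n.+1 -> R) : Prop :=
  forall eps : R, 0 < eps < 1 -> exists K : nat, confidence_size mu eps K.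

Lemma attach_pmf_ge0 n (f : {ffun 'I_n -> 'I_n.+1}) : 0 <= attach_pmf f.
Proof. by apply: prodr_ge0 => i _; rewrite divr_ge0. Qed.

Lemma attach_pmf_sum1 n : \sum_(f : {ffun 'I_n -> 'I_n.+1}) attach_pmf f = 1.
Proof.
rewrite -(bigA_distr_bigA (fun (i : 'I_n) (v : 'I_n.+1) =>
  ((v <= i)%N%:R / i.+1%:R : R))).
apply: big1 => i _; rewrite -mulr_suml -natr_sum.
have -> : (\sum_(v < n.+1) (v <= i)%N = i.+1)%N.
  rewrite -(big_mkord xpredT (fun v => nat_of_bool (v <= i)%N)).
  rewrite (@big_cat_nat _ _ _ i.+1) //=; last by rewrite ltnS ltnW.
  rewrite (eq_big_nat _ _ (F2 := fun=> 1%N)); last first.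
    by move=> v /andP[_]; rewrite ltnS => ->.
  rewrite sum_nat_const_nat subn0 muln1 big_nat big1 ?addn0 //.
  by move=> v /andP[iv _]; rewrite leqNgt iv.
by rewrite divff // pnatr_eq0.
Qed.

Lemma recursive_tree_pmf_ge0 n (T : sgraph n.+1) : 0 <= recursive_tree_pmf T.
Proof. by apply: sumr_ge0 => f _; apply: attach_pmf_ge0. Qed.

Lemma recursive_tree_pmf_sum1 n :
  \sum_(T : sgraph n.+1) recursive_tree_pmf T = 1.
Proof.
rewrite -(attach_pmf_sum1 n) /recursive_tree_pmf.
rewrite (exchange_big_dep xpredT) //=; apply: eq_bigr => f _.
have [fP|fN] := boolP [forall i : 'I_n, (f i <= i)%N]; last first.
  suff -> : attach_pmf f = 0 by rewrite big1.
  move: fN; rewrite negb_forall => /existsP[i fi].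
  by rewrite /attach_pmf (bigD1 i) //= (negbTE fi) !mul0r.
have eP : [forall e in attach_edges f, #|e| == 2].
  apply/forall_inP => _ /imsetP[i _ ->]; rewrite cards2.
  suff -> : lift ord0 i != f i by [].
  apply/eqP => /(congr1 val) /= E; move/forallP/(_ i): fP.
  by rewrite -E ltnn.
rewrite (big_pred1 (SGraph eP)) // => T /=.
by rewrite -val_eqE /= eq_sym.
Qed.

Lemma recursive_dag_pmf_ge0 l n (G : sgraph n.+1) : 0 <= recursive_dag_pmf l G.
Proof.
apply: sumr_ge0 => T _; apply: prodr_ge0 => j _.
exact: recursive_tree_pmf_ge0.
Qed.

Lemma recursive_dag_pmf_sum1 l n :
  \sum_(G : sgraph n.+1) recursive_dag_pmf l G = 1.
Proof.
rewrite /recursive_dag_pmf (exchange_big_dep xpredT) //=.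
under eq_bigr => T _ do rewrite (big_pred1 (gunion T)) //.
rewrite -(bigA_distr_bigA (fun=> @recursive_tree_pmf n)).
by apply: big1 => j _; apply: recursive_tree_pmf_sum1.
Qed.

End RandomGraphs.

(* Main.v *)
Require Import Defs.
From mathcomp Require Import all_boot all_order all_algebra all_fingroup.
From mathcomp Require Import ring lra zify.
From mathcomp Require Import boolp reals sequences exp.
Set Implicit Arguments.
Unset Strict Implicit.
Unset Printing Implicit Defensive.
Import Order.TTheory GRing.Theory Num.Theory.
Local Open Scope ring_scope.

(** Suppose that a label-free property of vertices is likely for the root and
    holds on average for at most M vertices, whatever n is. By Markov's
    inequality the set of all vertices with the property, replaced by the empty
    set when it has more than 2 M / eps elements, is a confidence set
    ([confidence_of_property]). This is where the factor 1/eps comes from. Two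
    properties are used.

    For l = 1 the graph is a tree, and the property is to be balanced: every
    component left when the vertex is removed misses a fraction 1/D of the
    vertices. The subtree of the second vertex has uniform size (a Polya urn,
    [Pr_subtree_size_unif]), so that both sides of the edge between the first
    two vertices are large and the root is balanced up to probability 2/D
    ([Pr_unbalanced_root]). A balanced vertex v other than the root has a
    subtree with a fraction 1/D of the vertices, and the second moment of the
    urn makes this unlikely enough to be summed over v ([Pr_balanced_sum]).
    With D of order 1/eps the confidence set has order eps^-3 elements, which is
    less than the bound to be proved.

    For l >= 2 the property is to lie on two short cycles: v is joined to some
    vertex w by three short walks without common edges, one of which may be
    empty, in which case the two others are cycles through v = w ([theta]).
    - Such vertices are rare ([Pr_theta_sum]). The edge between x < y is present
      with probability at most l/y, and for distinct edges these bounds can be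
      multiplied ([Pr_edges]). The kernel 1 / max(x, y) maps the function
      1 / sqrt(x) to at most 4 times itself, as in Hilbert's inequality, so that
      the walks of length a from v to w have total weight at most
      (8 l)^a / sqrt(v w) ([walk_sum_to]). Three walks give (v w)^(-3/2), whose
      sum over v and w converges. A single cycle would give 1/v, and indeed
      about log n vertices lie on short cycles.
    - The root has the property ([Pr_no_theta_root]). Take two of the trees. If
      x hangs from the root in the first tree but not in the second one, the
      edge from x to the root closes a cycle with the path from x to the root in
      the second tree; two such vertices x provide the three walks
      ([theta_at_root]). Among the first 2^(8 u + 1) vertices two such x exist
      up to probability 2 / 2^u, and the depths are at most 17 u + 2 up to
      probability 1 / 2^u. Disjoint pairs of trees are independent, hence the
      probability to fail is at most (3 / 2^u)^(l/2).

    With u of order log(1/eps) / l the root fails with probability at most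
    eps/2, while the walks have length O(u) and M = (8 l)^(O(u)). As
    16 l <= log(1/eps) this is the announced power of log(1/eps). *)

(** * Expectations over independent coordinates *)

Section ProductSpace.
Variables (R : realFieldType) (I T : finType) (p : I -> T -> R).
Implicit Types (F G : {ffun I -> T}) (phi psi : {ffun I -> T} -> R).

Definition weight F : R := \prod_i p i (F i).
Definition Ex phi : R := \sum_F weight F * phi F.
Definition Pr (P : {ffun I -> T} -> bool) : R := Ex (fun F => (P F)%:R).
Definition splice (A : {set I}) F G : {ffun I -> T} :=
  [ffun i => if i \in A then F i else G i].
Definition upd G i a : {ffun I -> T} := [ffun k => if k == i then a else G k].

Hypothesis p_ge0 : forall i a, 0 <= p i a.
Hypothesis p_sum1 : forall i, \sum_a p i a = 1.

Lemma weight_ge0 F : 0 <= weight F.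
Proof. exact: prodr_ge0. Qed.

Lemma Ex_ext phi psi : (forall F, phi F = psi F) -> Ex phi = Ex psi.
Proof. by move=> e; apply: eq_bigr => F _; rewrite e. Qed.

Lemma Ex_le phi psi :
  (forall F, (forall i, p i (F i) != 0) -> phi F <= psi F) -> Ex phi <= Ex psi.
Proof.
move=> le; apply: ler_sum => F _.
have [/eqP w0|w0] := boolP (weight F == 0); first by rewrite w0 !mul0r.
apply: ler_wpM2l; first exact: weight_ge0.
by apply: le => i; move/prodf_neq0: w0; apply.
Qed.

Lemma Ex_prod (g : I -> T -> R) :
  Ex (fun F => \prod_i g i (F i)) = \prod_i \sum_a p i a * g i a.
Proof.
rewrite (bigA_distr_bigA (fun i a => p i a * g i a)).
by apply: eq_bigr => F _; rewrite -big_split.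
Qed.

Lemma Ex_cst c : Ex (fun=> c) = c.
Proof.
rewrite /Ex -mulr_suml -[RHS]mul1r; congr (_ * _).
rewrite -(bigA_distr_bigA p); exact: big1.
Qed.

Lemma ExD phi psi : Ex (fun F => phi F + psi F) = Ex phi + Ex psi.
Proof. by rewrite -big_split; apply: eq_bigr => F _; rewrite mulrDr. Qed.

Lemma ExZl c phi : Ex (fun F => c * phi F) = c * Ex phi.
Proof. by rewrite mulr_sumr; apply: eq_bigr => F _; rewrite mulrCA. Qed.

Lemma ExZr c phi : Ex (fun F => phi F * c) = Ex phi * c.
Proof. by rewrite mulr_suml; apply: eq_bigr => F _; rewrite mulrA. Qed.

Lemma Ex_sum (J : Type) (r : seq J) (Q : pred J) (g : J -> {ffun I -> T} -> R) :
  Ex (fun F => \sum_(j <- r | Q j) g j F) = \sum_(j <- r | Q j) Ex (g j).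
Proof. by rewrite exchange_big; apply: eq_bigr => F _; rewrite mulr_sumr. Qed.

Lemma Ex_ge0 phi : (forall F, 0 <= phi F) -> 0 <= Ex phi.
Proof. by move=> h; apply: sumr_ge0 => F _; rewrite mulr_ge0 // weight_ge0. Qed.

Lemma Pr_ge0 P : 0 <= Pr P.
Proof. by apply: Ex_ge0. Qed.

Lemma Pr_le1 P : Pr P <= 1.
Proof.
rewrite -[leRHS](Ex_cst 1); apply: Ex_le => F _.
by rewrite (ler_nat _ _ 1%N) leq_b1.
Qed.

Lemma PrC P : Pr (fun F => ~~ P F) = 1 - Pr P.
Proof.
rewrite -[X in X - _](Ex_cst 1) -[Ex _ - _]/(Ex _ + - Pr P).
rewrite -[- Pr P]mulN1r -ExZl -ExD; apply: Ex_ext => F.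
by case: (P F); rewrite /= ?mulr1 ?mulr0 ?addr0 ?subrr.
Qed.

Lemma PrU P Q : Pr (fun F => P F || Q F) <= Pr P + Pr Q.
Proof.
rewrite -ExD; apply: Ex_le => F _.
by rewrite -natrD ler_nat; case: (P F); case: (Q F).
Qed.

Lemma Pr_has (J : Type) (r : seq J) (P : J -> {ffun I -> T} -> bool) :
  Pr (fun F => has (P^~ F) r) <= \sum_(j <- r) Pr (P j).
Proof.
rewrite -Ex_sum; apply: Ex_le => F _; elim: r => [|j r IH] /=.
  by rewrite big_nil.
rewrite big_cons; apply: le_trans (lerD (lexx _) IH).
by rewrite -natrD ler_nat; case: (P j F); case: has.
Qed.

Lemma splice_weight A F G :
  weight (splice A F G) * weight (splice A G F) = weight F * weight G.
Proof.
rewrite -!big_split; apply: eq_bigr => i _ /=.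
by rewrite !ffunE; case: ifP => // _; rewrite mulrC.
Qed.

Lemma spliceK A F G : splice A (splice A F G) (splice A G F) = F.
Proof. by apply/ffunP => i; rewrite !ffunE; case: (i \in A). Qed.

(** Exchanging the coordinates in [A] of two independent points preserves their
    joint law; all uses of independence below come from this. *)
Lemma Ex_splice A phi : Ex phi = Ex (fun G => Ex (fun F => phi (splice A F G))).
Proof.
transitivity (\sum_(u : {ffun I -> T} * {ffun I -> T})
    weight u.1 * weight u.2 * phi u.1).
  rewrite -(pair_bigA _ (fun F G => weight F * weight G * phi F)) /=.
  apply: eq_bigr => F _; rewrite -mulr_suml -mulr_sumr; congr (_ * _).
  rewrite -[LHS]mulr1 -[X in _ * X](Ex_cst 1); congr (_ * _).
  by apply: eq_bigr => G _; rewrite mulr1.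
pose h (u : {ffun I -> T} * {ffun I -> T}) := (splice A u.1 u.2, splice A u.2 u.1).
have hK : involutive h.
  by move=> [F G]; rewrite /h /= !spliceK.
rewrite (reindex_inj (can_inj hK)) /= -(pair_bigA _ (fun F G =>
  weight (splice A F G) * weight (splice A G F) * phi (splice A F G))) /=.
rewrite exchange_big; apply: eq_bigr => G _; rewrite mulr_sumr.
by apply: eq_bigr => F _; rewrite splice_weight -mulrA mulrCA mulrA.
Qed.

Lemma Ex_indep A phi psi :
    (forall F G, phi (splice A F G) = phi F) ->
    (forall F G, psi (splice A F G) = psi G) ->
  Ex (fun F => phi F * psi F) = Ex phi * Ex psi.
Proof.
move=> hphi hpsi; rewrite (Ex_splice A) -ExZl; apply: Ex_ext => G.
by rewrite -ExZr; apply: Ex_ext => F; rewrite hphi hpsi.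
Qed.

Lemma Pr_indep A (P Q : {ffun I -> T} -> bool) :
    (forall F G, P (splice A F G) = P F) ->
    (forall F G, Q (splice A F G) = Q G) ->
  Pr (fun F => P F && Q F) = Pr P * Pr Q.
Proof.
move=> hP hQ; rewrite -(Ex_indep (A := A)) => [|F G|F G]; last 2 first.
- by rewrite hP.
- by rewrite hQ.
by apply: Ex_ext => F; case: (P F); case: (Q F); rewrite ?mulr1 ?mulr0.
Qed.

Lemma Ex_coord i (g : T -> R) : Ex (fun F => g (F i)) = \sum_a p i a * g a.
Proof.
transitivity (Ex (fun F => \prod_k (if k == i then g (F k) else 1))).
  by apply: Ex_ext => F; rewrite -big_mkcond big_pred1_eq.
rewrite (Ex_prod (fun k a => if k == i then g a else 1)) (bigD1 i) //= eqxx.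
rewrite [X in _ * X]big1 ?mulr1 // => k /negbTE ->.
by rewrite -[RHS](p_sum1 k); apply: eq_bigr => a _; rewrite mulr1.
Qed.

(** Resampling: the value at [i] may be drawn again, independently of the rest.
    This reveals one parent at a time. *)
Lemma Ex_upd i phi : Ex phi = Ex (fun G => \sum_a p i a * phi (upd G i a)).
Proof.
rewrite (Ex_splice [set i]); apply: Ex_ext => G.
rewrite -(Ex_coord i (fun a => phi (upd G i a))); apply: Ex_ext => F.
congr phi; apply/ffunP => k; rewrite !ffunE inE.
by case: eqP => // ->.
Qed.

End ProductSpace.

(** * The dag as a function of independent parents *)

Section DagModel.
Variables (R : realType) (l n : nat).
Local Notation V := 'I_n.+1.
Local Notation coord := ('I_l * 'I_n)%type.
Implicit Types (F G : {ffun coord -> V}) (j : 'I_l) (c : coord) (x y v : V).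

Definition attach_prob c v : R := (v <= c.2)%N%:R / c.2.+1%:R.

Lemma attach_prob_ge0 c v : 0 <= attach_prob c v.
Proof. by rewrite divr_ge0. Qed.

Lemma sum_ord_leq (i : 'I_n) (g : nat -> R) :
  \sum_(v : V) (v <= i)%N%:R * g v = \sum_(k < i.+1) g k.
Proof.
rewrite (eq_bigr (fun v : V => if (v < i.+1)%N then g v else 0)); last first.
  by move=> v _; rewrite ltnS; case: leqP; rewrite ?mul1r ?mul0r.
by rewrite -big_mkcond /= [RHS](big_ord_widen n.+1 g) // ltnS ltnW.
Qed.

Lemma attach_avg c (g : nat -> R) :
  \sum_v attach_prob c v * g v = (\sum_(k < c.2.+1) g k) / c.2.+1%:R.
Proof.
rewrite -sum_ord_leq mulr_suml; apply: eq_bigr => v _.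
by rewrite /attach_prob mulrAC.
Qed.

Lemma attach_prob_sum1 c : \sum_v attach_prob c v = 1.
Proof.
transitivity (\sum_v attach_prob c v * 1); first by apply: eq_bigr => v _; rewrite mulr1.
by rewrite (attach_avg _ (fun=> 1)) sumr_const card_ord divff ?pnatr_eq0.
Qed.

Lemma attach_prob_neq0 c v : attach_prob c v != 0 -> (v <= c.2)%N.
Proof. by rewrite /attach_prob; case: leqP => //; rewrite mul0r eqxx. Qed.

Fact tree_graph_subproof (f : {ffun 'I_n -> V}) :
  [forall e in [set e in attach_edges f | #|e| == 2], #|e| == 2].
Proof. by apply/forall_inP => e; rewrite inE => /andP[]. Qed.

(** Loops are dropped, so that every map of parents, including those of mass 0,
    gives a graph. *)
Definition tree_graph (f : {ffun 'I_n -> V}) : sgraph n.+1 :=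
  SGraph (tree_graph_subproof f).

Definition dag F : sgraph n.+1 :=
  gunion [ffun j : 'I_l => tree_graph [ffun i => F (j, i)]].

Lemma recursive_tree_pmfE (T : sgraph n.+1) :
  recursive_tree_pmf R T = \sum_f attach_pmf R f * (tree_graph f == T)%:R.
Proof.
rewrite /recursive_tree_pmf big_mkcond; apply: eq_bigr => f _.
have [fP|fN] := boolP [forall i : 'I_n, (f i <= i)%N]; last first.
  suff -> : attach_pmf R f = 0 by rewrite mul0r; case: ifP.
  move: fN; rewrite negb_forall => /existsP[i fi].
  by rewrite /attach_pmf (bigD1 i) //= (negbTE fi) !mul0r.
suff -> : (tree_graph f == T) = (attach_edges f == edges T).
  by case: eqP; rewrite ?mulr1 ?mulr0.
rewrite -val_eqE /=; congr (_ == _).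
apply/setP => e; rewrite inE andb_idr // => /imsetP[i _ ->]; rewrite cards2.
suff -> : lift ord0 i != f i by [].
apply/eqP => /(congr1 val) /= E; move/forallP/(_ i): fP.
by rewrite -E ltnn.
Qed.

(** The law of the dag is the image by [dag] of the product law of the parents:
    every probability below can be computed on independent coordinates. *)
Lemma sum_recursive_dag_pmf (Q : sgraph n.+1 -> bool) :
  \sum_(H | Q H) recursive_dag_pmf R l H = Pr attach_prob (fun F => Q (dag F)).
Proof.
rewrite /recursive_dag_pmf (exchange_big_dep xpredT) //=.
transitivity (\sum_(T : {ffun 'I_l -> sgraph n.+1})
    \sum_(G : {ffun 'I_l -> {ffun 'I_n -> V}})
      \prod_j (attach_pmf R (G j) * (tree_graph (G j) == T j)%:R)
        * (Q (gunion T))%:R).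
  apply: eq_bigr => T _; rewrite -mulr_suml.
  rewrite -(bigA_distr_bigA (fun j f => attach_pmf R f * (tree_graph f == T j)%:R)).
  rewrite -(eq_bigr _ (fun j _ => recursive_tree_pmfE (T j))).
  have [QT|QT] := boolP (Q (gunion T)); last first.
    rewrite mulr0 big1 // => H /andP[QH /eqP E].
    by rewrite E QH in QT.
  rewrite mulr1 (big_pred1 (gunion T)) // => H /=.
  by rewrite [RHS]eq_sym; case: eqP => [<-|]; rewrite ?QT ?andbF.
rewrite exchange_big /=.
transitivity (\sum_(G : {ffun 'I_l -> {ffun 'I_n -> V}})
    (\prod_j attach_pmf R (G j)) *
     (Q (gunion [ffun j => tree_graph (G j)]))%:R).
  apply: eq_bigr => G _; rewrite (bigD1 [ffun j => tree_graph (G j)]) //=.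
  rewrite [X in _ + X]big1 ?addr0; last first.
    move=> T; rewrite eq_sym => /eqP TG; rewrite big_split /=.
    have [j TGj] : exists j, tree_graph (G j) != T j.
      apply/existsP; rewrite -negb_forall; apply/forallP => h; apply: TG.
      by apply/ffunP => j; rewrite ffunE; apply/eqP.
    by rewrite (bigD1 j (F := fun j => (tree_graph (G j) == T j)%:R)) //=
      (negbTE TGj) !(mul0r, mulr0).
  congr (_ * _); rewrite big_split /= [X in _ * X]big1 ?mulr1 // => j _.
  by rewrite ffunE eqxx.
pose curry F : {ffun 'I_l -> {ffun 'I_n -> V}} := [ffun j => [ffun i => F (j, i)]].
pose uncurry (G : {ffun 'I_l -> {ffun 'I_n -> V}}) : {ffun coord -> V} :=
  [ffun c => G c.1 c.2].
have curryK : cancel curry uncurry.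
  by move=> F; apply/ffunP => -[j i]; rewrite !ffunE.
have uncurryK : cancel uncurry curry.
  by move=> G; apply/ffunP => j; apply/ffunP => i; rewrite !ffunE.
rewrite (reindex curry) /=; last by exists uncurry => ? _.
apply: eq_bigr => F _.
have -> : gunion [ffun j => tree_graph (curry F j)] = dag F.
  by congr gunion; apply/ffunP => j; rewrite !ffunE.
congr (_ * _).
rewrite /weight (eq_bigr (fun c => attach_prob (c.1, c.2) (F (c.1, c.2)))).
  2: by case.
rewrite -(pair_bigA _ (fun j i => attach_prob (j, i) (F (j, i)))) /=.
by apply: eq_bigr => j _; apply: eq_bigr => i _; rewrite !ffunE.
Qed.

Lemma dag_edge F e :
  (e \in edges (dag F)) =
  (#|e| == 2) && [exists c, e == [set lift ord0 c.2; F c]].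
Proof.
apply/bigcupP/andP => [[j _]|[e2 /existsP[[j i] /= /eqP ee]]].
  rewrite ffunE inE => /andP[/imsetP[i _ ei] e2]; split=> //.
  by apply/existsP; exists (j, i); rewrite ei ffunE.
exists j => //; rewrite ffunE inE e2 andbT; apply/imsetP; exists i => //.
by rewrite ffunE.
Qed.

(** The root is its own parent, so that paths to the root are iterates. *)
Definition par F j x : V := if unlift ord0 x is Some i then F (j, i) else ord0.

Definition valid F := forall c, (F c <= c.2)%N.

Lemma par0 F j : par F j ord0 = ord0.
Proof. by rewrite /par unlift_none. Qed.

Lemma par_lift F j (i : 'I_n) : par F j (lift ord0 i) = F (j, i).
Proof. by rewrite /par liftK. Qed.

Lemma par_lt F j x : valid F -> x != ord0 -> (par F j x < x)%N.
Proof.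
move=> vF; rewrite eq_sym => /unlift_some[i -> _]; rewrite par_lift.
by have := vF (j, i); rewrite lift0 ltnS.
Qed.

Lemma par_le F j x : valid F -> (par F j x <= x)%N.
Proof.
move=> vF; have [->|/(par_lt j vF)/ltnW//] := eqVneq x ord0.
by rewrite par0.
Qed.

Lemma iter_par_le F j x k : valid F -> (iter k (par F j) x <= x)%N.
Proof.
by move=> vF; elim: k => //= k; apply: leq_trans; apply: par_le.
Qed.

Lemma par_edge F j x : valid F -> x != ord0 ->
  [set x; par F j x] \in edges (dag F).
Proof.
move=> vF x0; rewrite dag_edge cards2; apply/andP; split.
  suff -> : x != par F j x by [].
  by apply/eqP => /(congr1 val) /= E; have := par_lt j vF x0; rewrite -E ltnn.
move: x0; rewrite eq_sym => /unlift_some[i -> _].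
by apply/existsP; exists (j, i); rewrite par_lift.
Qed.

Lemma edge_par F x y : valid F -> [set x; y] \in edges (dag F) -> x != y ->
  exists j, (x != ord0 /\ y = par F j x) \/ (y != ord0 /\ x = par F j y).
Proof.
move=> vF; rewrite dag_edge => /andP[_ /existsP[[j i] /= /eqP E]] xy; exists j.
have xE : x \in [set lift ord0 i; F (j, i)] by rewrite -E set21.
have yE : y \in [set lift ord0 i; F (j, i)] by rewrite -E set22.
rewrite -(par_lift F j) in xE yE.
case/set2P: xE xy => ->; case/set2P: yE => ->; rewrite ?eqxx // => _.
  by left.
by right.
Qed.

Lemma iter_par_upd G j (i : 'I_n) a k y : valid G -> (y <= i)%N ->
  iter k (par (upd G (j, i) a) j) y = iter k (par G j) y.
Proof.
move=> vG yi; elim: k => //= k ->; rewrite /par.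
case: unliftP => // i' E; rewrite ffunE; case: eqP => // -[ii].
have := leq_trans (iter_par_le j y k vG) yi; rewrite E ii.
by rewrite lift0 ltnn.
Qed.

Local Notation E := (Ex attach_prob).
Local Notation P := (Pr attach_prob).

Lemma Ex_le_valid (phi psi : {ffun coord -> V} -> R) :
  (forall F, valid F -> phi F <= psi F) -> E phi <= E psi.
Proof.
move=> le; apply: (Ex_le attach_prob_ge0) => F F0; apply: le => c.
exact: attach_prob_neq0.
Qed.

Lemma Ex_eq_valid (phi psi : {ffun coord -> V} -> R) :
  (forall F, valid F -> phi F = psi F) -> E phi = E psi.
Proof. by move=> e; apply/eqP; rewrite eq_le !Ex_le_valid // => F /e ->. Qed.

Lemma Pr_le_valid (Q Q' : {ffun coord -> V} -> bool) :
  (forall F, valid F -> Q F -> Q' F) -> P Q <= P Q'.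
Proof.
move=> h; apply: Ex_le_valid => F /h; case: (Q F) => [/(_ isT) -> //|_].
exact: ler0n.
Qed.

Lemma Ex_attach j (i : 'I_n) (phi : {ffun coord -> V} -> R) :
  E phi = E (fun G => \sum_a attach_prob (j, i) a * phi (upd G (j, i) a)).
Proof. exact: (Ex_upd attach_prob_sum1). Qed.

(** A potential argument: the average of [k.+1] over the possible parents [k] of
    [x] is [x.+1 / 2], hence every step towards the root halves the bound. *)
Lemma Pr_depth j d x :
  P (fun F => iter d (par F j) x != ord0) <= x.+1%:R / 2 ^+ d.
Proof.
elim: d x => [|d IH] x.
  rewrite expr0 divr1; apply: (le_trans (Pr_le1 attach_prob_ge0 attach_prob_sum1 _)).
  by rewrite ler1n.
have [->|] := eqVneq x ord0.
  rewrite [leLHS](_ : _ = 0) ?divr_ge0 ?exprn_ge0 //.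
  rewrite /Pr /Ex big1 // => F _.
  suff -> : iter d.+1 (par F j) ord0 = ord0 by rewrite eqxx mulr0.
  by elim: d.+1 => //= k ->; rewrite par0.
rewrite eq_sym => /unlift_some[i -> _].
rewrite {1}/Pr (Ex_attach j i).
apply: (@le_trans _ _ (\sum_a attach_prob (j, i) a *
    P (fun F => iter d (par F j) a != ord0))).
  rewrite -[leRHS]/(\sum_a attach_prob (j, i) a * E _).
  under [leRHS]eq_bigr do rewrite -ExZl.
  rewrite -Ex_sum; apply: Ex_le_valid => G vG.
  apply: ler_sum => a _.
  have [->|/attach_prob_neq0 ai] := eqVneq (attach_prob (j, i) a) 0.
    by rewrite !mul0r.
  rewrite iterSr par_lift ffunE eqxx iter_par_upd //.
apply: (@le_trans _ _ (\sum_(a : V) attach_prob (j, i) a * (a.+1%:R / 2 ^+ d))).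
  by apply: ler_sum => a _; rewrite ler_wpM2l ?attach_prob_ge0.
rewrite (attach_avg _ (fun k => k.+1%:R / 2 ^+ d)) -mulr_suml lift0 /=.
have -> : \sum_(k < i.+1) k.+1%:R = i.+1%:R * i.+2%:R / 2 :> R.
  elim: (nat_of_ord i) => [|m IH']; first by rewrite big_ord_recr big_ord0 /=; field.
  by rewrite big_ord_recr /= IH' -(natr1 m.+2) -(natr1 m.+1); field.
rewrite exprS invfM; rewrite le_eqVlt; apply/predU1P; left.
by field; rewrite nat1r pnatr_eq0 expf_neq0 ?pnatr_eq0.
Qed.

End DagModel.

(** * Sums of inverse square roots *)

Section SqrtSums.
Variable R : realType.

Definition isqrt (k : nat) : R := (Num.sqrt k.+1%:R)^-1.

Lemma isqrt_gt0 k : 0 < isqrt k.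
Proof. by rewrite invr_gt0 sqrtr_gt0 ltr0n. Qed.

Lemma isqrt_ge0 k : 0 <= isqrt k.
Proof. exact/ltW/isqrt_gt0. Qed.

Lemma isqrt_sq k : isqrt k * isqrt k = k.+1%:R^-1.
Proof. by rewrite -invfM -expr2 sqr_sqrtr ?ler0n. Qed.

Lemma isqrt_le k m : (k <= m)%N -> isqrt m <= isqrt k.
Proof.
move=> km; rewrite lef_pV2 ?posrE ?sqrtr_gt0 ?ltr0n //.
by rewrite ler_sqrt ?ler_nat ?ler0n.
Qed.

Lemma isqrt0 : isqrt 0 = 1.
Proof. by rewrite /isqrt sqrtr1 invr1. Qed.

Lemma isqrt_step k : isqrt k <= 2 * (Num.sqrt k.+1%:R - Num.sqrt k%:R).
Proof.
have : Num.sqrt (k.+1%:R : R) ^+ 2 = Num.sqrt (k%:R : R) ^+ 2 + 1.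
  by rewrite !sqr_sqrtr ?ler0n // natr1.
have : 0 < Num.sqrt (k.+1%:R : R) by rewrite sqrtr_gt0 ltr0n.
rewrite /isqrt; set a := Num.sqrt _; set b := Num.sqrt _ => a0 ab.
rewrite -(ler_pM2r a0) mulVf ?gt_eqF //; have := sqr_ge0 (a - b); nra.
Qed.

(** The telescoping bound for the sum of k^(-3/2), the derivative of
    -2 / sqrt k being k^(-3/2). *)
Lemma isqrt3_step k :
  isqrt k.+1 * k.+2%:R^-1 <= 2 * (isqrt k - isqrt k.+1).
Proof.
rewrite -isqrt_sq; have u0 := isqrt_gt0 k; have v0 := isqrt_gt0 k.+1.
have vu : isqrt k.+1 <= isqrt k by apply: isqrt_le.
have E : isqrt k ^+ 2 = isqrt k.+1 ^+ 2 + isqrt k ^+ 2 * isqrt k.+1 ^+ 2.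
  rewrite !expr2 !isqrt_sq -(natr1 k.+1); field.
  by rewrite nat1r natr1 !pnatr_eq0.
move: u0 v0 vu E; move: (isqrt k) (isqrt k.+1) => u v u0 v0 vu E.
have h1 : u ^+ 2 * v ^+ 2 <= 2 * (u - v) * u by nra.
have h2 : u * v ^+ 2 <= 2 * (u - v).
  by rewrite -(ler_pM2r u0); apply: le_trans h1; nra.
by apply: le_trans h2; rewrite -expr2 ler_wpM2r ?sqr_ge0.
Qed.

Lemma sum_isqrt m : \sum_(0 <= k < m) isqrt k <= 2 * Num.sqrt m%:R.
Proof.
elim: m => [|m IH]; first by rewrite big_geq // sqrtr0 mulr0.
rewrite big_nat_recr //=; have := isqrt_step m; lra.
Qed.

Lemma sum_isqrt3 m N :
  \sum_(m.+1 <= k < N) isqrt k * k.+1%:R^-1 <= 2 * isqrt m.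
Proof.
have [Nm|mN] := leqP N m.+1.
  by rewrite big_geq // mulr_ge0 ?isqrt_ge0.
suff H : \sum_(m.+1 <= k < N) isqrt k * k.+1%:R^-1
    <= 2 * isqrt m - 2 * isqrt N.-1.
  by apply: (le_trans H); rewrite gerBl mulr_ge0 ?isqrt_ge0.
elim: N mN => // N IH; rewrite ltnS leq_eqVlt => /predU1P[<-|mN].
  rewrite big_nat1; have := isqrt3_step m.
  by rewrite mulrBr; apply.
rewrite big_nat_recr 1?ltnW //=; have := IH mN.
case: N mN {IH} => // N _; have := isqrt3_step N; rewrite /=.
set S := \sum_(_ <= _ < _) _; set T := _ * _^-1; lra.
Qed.

End SqrtSums.

(** * Weighted walks for the kernel 1 / max *)

Section Walks.
Variables (R : realType) (l n : nat).
Local Notation V := 'I_n.+1.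
Implicit Types (v w x y z : V) (p q r : seq V).
Local Notation isqrt := (isqrt R).

(** Twice the bound l / max(x, y) on the probability of an edge, up to the shift
    of the labels by one, which keeps it finite at the root and comparable with
    [isqrt]. *)
Definition kernel x y : R := 2 * l%:R / (maxn x y).+1%:R.

Fixpoint walk_weight v p : R :=
  if p is x :: p' then kernel v x * walk_weight x p' else 1.

Fixpoint walks (a : nat) : seq (seq V) :=
  if a is a'.+1 then [seq x :: p | x <- enum V, p <- walks a'] else [:: [::]].

Definition walk_sum a v (g : V -> R) : R :=
  \sum_(p <- walks a) walk_weight v p * g (last v p).

Lemma mem_walks a p : (p \in walks a) = (size p == a).
Proof.
elim: a p => [|a IH] [|x p] //=.
  by apply/negbTE/negP => /allpairsP[[y q] /= [_ _]].
apply/allpairsP/idP => [[[y q] /= [_ qa [_ ->]]]|]; first by rewrite eqSS -IH.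
by rewrite eqSS -IH => pa; exists (x, p); rewrite mem_enum.
Qed.

Lemma kernel_ge0 x y : 0 <= kernel x y.
Proof. by rewrite divr_ge0 ?mulr_ge0 ?ler0n. Qed.

Lemma walk_weight_ge0 v p : 0 <= walk_weight v p.
Proof. by elim: p v => [|x p IH] v //=; rewrite mulr_ge0 ?kernel_ge0. Qed.

Lemma walk_sum0 v g : walk_sum 0 v g = g v.
Proof. by rewrite /walk_sum big_seq1 /= mul1r. Qed.

Lemma walk_sumS a v g :
  walk_sum a.+1 v g = \sum_x kernel v x * walk_sum a x g.
Proof.
rewrite /walk_sum /= big_allpairs_dep big_enum /=; apply: eq_bigr => x _.
by rewrite mulr_sumr; apply: eq_bigr => p _; rewrite mulrA.
Qed.

(** Schur's test for Hilbert's kernel 1 / max(x, y) with test function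
    1 / sqrt x: the labels up to [v] and those above [v] each contribute at most
    half of the bound. *)
Lemma kernel_isqrt v : \sum_x kernel v x * isqrt x <= 8 * l%:R * isqrt v.
Proof.
have -> : \sum_x kernel v x * isqrt x =
    2 * l%:R * \sum_(0 <= k < n.+1) isqrt k / (maxn v k).+1%:R.
  rewrite big_mkord mulr_sumr; apply: eq_bigr => x _.
  by rewrite /kernel mulrAC mulrA.
rewrite (_ : 8 * l%:R * isqrt v = 2 * l%:R * (4 * isqrt v)); last by ring.
apply: ler_wpM2l; first by rewrite mulr_ge0.
rewrite (big_cat_nat (n := v.+1)) //=.
rewrite (_ : 4 * isqrt v = 2 * isqrt v + 2 * isqrt v); last by ring.
apply: lerD; last first.
  apply: le_trans (sum_isqrt3 R v n.+1); rewrite le_eqVlt; apply/predU1P; left.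
  apply: eq_big_nat => k /andP[vk _].
  by rewrite (maxn_idPr (ltnW vk)).
rewrite (eq_big_nat _ _ (F2 := fun k => isqrt k * v.+1%:R^-1)); last first.
  by move=> k; rewrite ltnS /= => kv; rewrite (maxn_idPl kv).
rewrite -mulr_suml -isqrt_sq mulrA ler_wpM2r ?isqrt_ge0 //.
apply: (@le_trans _ _ (2 * Num.sqrt v.+1%:R * isqrt v)).
  by rewrite ler_wpM2r ?isqrt_ge0 // sum_isqrt.
by rewrite /isqrt -mulrA divff ?mulr1 // gt_eqF // sqrtr_gt0 ltr0n.
Qed.

Lemma walk_sum_isqrt a v :
  walk_sum a v isqrt <= (8 * l%:R) ^+ a * isqrt v.
Proof.
elim: a v => [|a IH] v; first by rewrite walk_sum0 mul1r.
rewrite walk_sumS.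
apply: (@le_trans _ _ (\sum_x kernel v x * ((8 * l%:R) ^+ a * isqrt x))).
  by apply: ler_sum => x _; rewrite ler_wpM2l ?kernel_ge0.
under eq_bigr do rewrite mulrCA.
rewrite -mulr_sumr exprSr -mulrA ler_wpM2l ?kernel_isqrt //.
by rewrite exprn_ge0 ?mulr_ge0.
Qed.

Lemma kernel_le v w : kernel v w <= 8 * l%:R * (isqrt v * isqrt w).
Proof.
rewrite /kernel; apply: (@le_trans _ _ (2 * l%:R * (isqrt v * isqrt w))).
  rewrite ler_wpM2l ?mulr_ge0 // -isqrt_sq.
  apply: ler_pM; rewrite ?isqrt_ge0 //; apply: isqrt_le.
  - exact: leq_maxl.
  - exact: leq_maxr.
rewrite ler_wpM2r ?mulr_ge0 ?isqrt_ge0 // ler_wpM2r // ler_nat //.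
Qed.

(** The first step costs 1 / max(v, w), which is at most 1 / sqrt(v w); the
    others are applications of [kernel_isqrt]. *)
Lemma walk_sum_to a v w :
  walk_sum a.+1 v (fun u => (u == w)%:R) <=
  (8 * l%:R) ^+ a.+1 * (isqrt v * isqrt w).
Proof.
elim: a v => [|a IH] v; rewrite walk_sumS.
  rewrite (bigD1 w) //= walk_sum0 eqxx mulr1 big1 ?addr0 ?expr1 ?kernel_le //.
  by move=> x xw; rewrite walk_sum0 (negbTE xw) mulr0.
apply: (@le_trans _ _ (\sum_x kernel v x *
    ((8 * l%:R) ^+ a.+1 * (isqrt x * isqrt w)))).
  by apply: ler_sum => x _; rewrite ler_wpM2l ?kernel_ge0.
rewrite (eq_bigr (fun x : V => (kernel v x * isqrt x) *
    ((8 * l%:R) ^+ a.+1 * isqrt w))); last by move=> x _; ring.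
rewrite -mulr_suml [in leRHS]exprS.
apply: (@le_trans _ _ ((8 * l%:R * isqrt v) * ((8 * l%:R) ^+ a.+1 * isqrt w))).
  rewrite ler_wpM2r ?kernel_isqrt //.
  by rewrite mulr_ge0 ?isqrt_ge0 // exprn_ge0 // mulr_ge0.
by rewrite le_eqVlt; apply/predU1P; left; ring.
Qed.

Definition walks_range m t := flatten [seq walks a | a <- iota m t].

Lemma mem_walks_range m t p :
  (p \in walks_range m t) = (m <= size p < m + t)%N.
Proof.
apply/flatten_mapP/idP => [[a]|pa].
  by rewrite mem_iota mem_walks => ? /eqP->.
by exists (size p); rewrite ?mem_iota ?mem_walks.
Qed.

Lemma sum_walks_range m t v g :
  \sum_(p <- walks_range m t) walk_weight v p * g (last v p) =
  \sum_(m <= a < m + t) walk_sum a v g.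
Proof.
by rewrite big_flatten big_map /index_iota addKn.
Qed.

Hypothesis l_gt0 : (0 < l)%N.

Lemma l8_ge1 : 1 <= 8 * l%:R :> R.
Proof. by rewrite -natrM ler1n muln_gt0. Qed.

Lemma sum_walks_isqrt t v :
  \sum_(p <- walks_range 0 t.+1) walk_weight v p * isqrt (last v p)
    <= t.+1%:R * (8 * l%:R) ^+ t * isqrt v.
Proof.
rewrite (sum_walks_range 0 t.+1 v isqrt) add0n big_mkord.
apply: (@le_trans _ _ (\sum_(a < t.+1) (8 * l%:R) ^+ t * isqrt v)).
  apply: ler_sum => a _; apply: (le_trans (walk_sum_isqrt a v)).
  by rewrite ler_wpM2r ?isqrt_ge0 // ler_weXn2l ?l8_ge1 // -ltnS.
by rewrite sumr_const card_ord -mulrA -[leLHS]mulr_natl.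
Qed.

Lemma sum_walks_to t v w :
  \sum_(p <- walks_range 1 t) walk_weight v p * (last v p == w)%:R
    <= t%:R * (8 * l%:R) ^+ t * (isqrt v * isqrt w).
Proof.
rewrite (sum_walks_range 1 t v (fun u => (u == w)%:R)).
rewrite big_add1 add1n /= big_mkord.
apply: (@le_trans _ _ (\sum_(a < t) (8 * l%:R) ^+ t * (isqrt v * isqrt w))).
  apply: ler_sum => a _; apply: (le_trans (walk_sum_to a v w)).
  by rewrite ler_wpM2r ?mulr_ge0 ?isqrt_ge0 // ler_weXn2l ?l8_ge1.
by rewrite sumr_const card_ord -mulrA -[leLHS]mulr_natl.
Qed.

(** For fixed ends [v] and [w] the walks [q] and [r] contribute [(v w)^-1] by
    [sum_walks_to]. The walk [p] back to [v] may be empty, hence it is summed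
    over its end [v] against the remaining weight [v^-1 <= v^(-1/2)], which
    leaves the convergent sum of [w^(-3/2)]. *)
Lemma sum_theta_weights t :
  \sum_v \sum_(q <- walks_range 1 t) \sum_(r <- walks_range 1 t)
   \sum_(p <- walks_range 0 t.+1)
     ((last v q == last v r) && (last (last v q) p == v))%:R *
     (walk_weight v q * walk_weight v r * walk_weight (last v q) p)
  <= 3 * t.+1%:R ^+ 3 * (8 * l%:R) ^+ (3 * t).
Proof.
set A := (8 * l%:R : R).
have A0 : 0 <= A by rewrite mulr_ge0.
rewrite [leLHS](_ : _ = \sum_v \sum_w
    (\sum_(q <- walks_range 1 t) walk_weight v q * (last v q == w)%:R) *
    (\sum_(r <- walks_range 1 t) walk_weight v r * (last v r == w)%:R) *
    (\sum_(p <- walks_range 0 t.+1) walk_weight w p * (last w p == v)%:R)).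
  2: {
  apply: eq_bigr => v _.
  under [RHS]eq_bigr do rewrite !mulr_suml.
  rewrite [RHS]exchange_big /=; apply: eq_bigr => q _.
  rewrite [RHS](bigD1 (last v q)) //= [X in _ + X]big1 ?addr0; last first.
    by move=> w; rewrite eq_sym => /negbTE ->; rewrite !(mulr0, mul0r).
  rewrite eqxx mulr1 -mulrA mulr_suml mulr_sumr; apply: eq_bigr => r _.
  rewrite !mulr_sumr; apply: eq_bigr => p _.
  rewrite (eq_sym (last v r)).
  by case: (_ == last v r); case: (_ == v); rewrite /= ?mulr1n ?mulr0n; ring. }
apply: (@le_trans _ _ (\sum_(v : V) \sum_(w : V)
    (t%:R * A ^+ t * (isqrt v * isqrt w)) ^+ 2 *
    (\sum_(p <- walks_range 0 t.+1) walk_weight w p * (last w p == v)%:R))).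
  apply: ler_sum => v _; apply: ler_sum => w _; rewrite ler_wpM2r //.
    by apply: sumr_ge0 => p _; rewrite mulr_ge0 ?walk_weight_ge0.
  by rewrite expr2 ler_pM ?sum_walks_to //;
    apply: sumr_ge0 => p _; rewrite mulr_ge0 ?walk_weight_ge0.
rewrite exchange_big /=.
apply: (@le_trans _ _ (\sum_(w : V) (t%:R * A ^+ t) ^+ 2 * isqrt w ^+ 2 *
    (t.+1%:R * A ^+ t * isqrt w))).
  apply: ler_sum => w _.
  apply: le_trans (ler_wpM2l _ (sum_walks_isqrt t w)); last first.
    by rewrite mulr_ge0 ?sqr_ge0.
  rewrite mulr_sumr.
  under eq_bigr do rewrite mulr_sumr.
  rewrite exchange_big /=; apply: ler_sum => p _.
  rewrite (bigD1 (last w p)) //= eqxx mulr1 big1 ?addr0; last first.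
    by move=> v; rewrite eq_sym => /negbTE ->; rewrite !mulr0.
  rewrite [leRHS]mulrCA mulrC ler_wpM2l ?walk_weight_ge0 //.
  rewrite exprMn -[leRHS]mulrA ler_wpM2l ?sqr_ge0 //.
  have := isqrt_ge0 R (last w p); have := isqrt_le R (leq0n (last w p)).
  rewrite isqrt0; have := sqr_ge0 (isqrt w).
  move: (isqrt w) (isqrt (last w p)) => a b; rewrite exprMn mulrC => a0 b1 b0.
  by rewrite ler_wpM2l // expr2 ler_piMl.
rewrite (eq_bigr (fun w : V => (t%:R ^+ 2 * t.+1%:R * A ^+ (3 * t)) *
    (isqrt w * w.+1%:R^-1))); last first.
  move=> w _; rewrite -isqrt_sq (_ : (3 * t)%N = (t + t + t)%N); last by lia.
  by rewrite !exprD; ring.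
rewrite -mulr_sumr -(big_mkord xpredT (fun k => isqrt k * k.+1%:R^-1)).
rewrite big_nat_recl // isqrt0 invr1 mulr1.
rewrite -(big_add1 _ _ 0 n.+1 xpredT (fun k => isqrt k * k.+1%:R^-1)).
have S3 := sum_isqrt3 R 0 n.+1; rewrite isqrt0 in S3.
apply: (@le_trans _ _ (t%:R ^+ 2 * t.+1%:R * A ^+ (3 * t) * 3)).
  rewrite ler_wpM2l ?mulr_ge0 ?exprn_ge0 ?ler0n //; lra.
rewrite mulrC mulrA ler_wpM2r ?exprn_ge0 // ler_wpM2l //.
have : 0 <= t%:R :> R by []; rewrite -natr1; set b := t%:R; nra.
Qed.

End Walks.

(** * Probability that given edges are present *)

Section EdgeProbability.
Variables (R : realType) (l n : nat).
Local Notation V := 'I_n.+1.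
Local Notation coord := ('I_l * 'I_n)%type.
Local Notation P := (Pr (@attach_prob R l n)).
Implicit Types (F G : {ffun coord -> V}) (c : coord) (x y v w : V).
Implicit Types (e : {set V}) (es : seq {set V}) (p q r : seq V).

(** The younger endpoint of an edge, which is the one that chose the other. *)
Definition top e : nat := \max_(x in e) x.

Lemma top2 x y : top [set x; y] = maxn x y.
Proof.
rewrite /top; have [->|xy] := eqVneq x y.
  by rewrite setUid big_set1 maxnn.
by rewrite big_setU1 ?inE //= big_set1.
Qed.

Definition child (c : coord) : V := lift ord0 c.2.

Lemma child_val c : child c = c.2.+1 :> nat.
Proof. by rewrite /child lift0. Qed.

Lemma dag_edgeP F e : valid F ->
  reflect (exists c, e = [set child c; F c]) (e \in edges (dag F)).
Proof.
move=> vF; rewrite dag_edge; apply: (iffP andP) => [[_ /existsP[c /eqP ->]]|].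
  by exists c.
case=> c ->; split; last by apply/existsP; exists c.
rewrite cards2; suff -> : child c != F c by [].
apply/eqP => /(congr1 (@nat_of_ord _)) cF; have := vF c.
by rewrite -cF child_val ltnn.
Qed.

Lemma edge_top F c : valid F -> top [set child c; F c] = c.2.+1.
Proof.
move=> vF; rewrite top2 child_val; apply/maxn_idPl.
by have := vF c; apply: leqW.
Qed.

Lemma attach_prob_pick c e :
  \sum_a attach_prob R c a * (e == [set child c; a])%:R <= c.2.+1%:R^-1.
Proof.
have [a0 /= ea0|noa] := pickP (fun a : V => (a <= c.2)%N && (e == [set child c; a]));
    last first.
  rewrite big1 ?invr_ge0 // => a _; have := noa a; rewrite /attach_prob.
  by case: (a <= c.2)%N => /= [->|_]; rewrite ?mulr0 ?mul0r.
have /andP[a0c /eqP ->] := ea0.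
rewrite (bigD1 a0) //= eqxx mulr1 big1 ?addr0 => [|a aa0]; last first.
  rewrite /attach_prob; case: leqP => ac; rewrite ?mul0r ?mul1r //.
  case: eqP; rewrite ?mulr0 // => /setP E.
  have := E a; rewrite !inE (negbTE aa0) eqxx orbT orbF => /eqP ac'.
  by move: ac; rewrite ac' child_val ltnn.
by rewrite /attach_prob a0c mul1r.
Qed.

(** Edges compete for coordinates: a coordinate that realizes the edge [e]
    realizes no other edge, so that the remaining edges are realized by the
    other coordinates, which are independent of it. Hence the probabilities
    multiply, as in the van den Berg-Kesten inequality. At most [l] coordinates
    can realize [e], one in each tree, each with probability [(top e)^-1]. *)
Lemma Pr_edges es : uniq es ->
  P (fun F => all (mem (edges (dag F))) es) <= \prod_(e <- es) (l%:R / (top e)%:R).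
Proof.
have pge0 := @attach_prob_ge0 R l n; have psum1 := @attach_prob_sum1 R l n.
elim: es => [_|e es IH]; first by rewrite big_nil Pr_le1.
rewrite cons_uniq => /andP[ees ues]; rewrite big_cons.
pose other c F := all (fun e' => (#|e'| == 2) &&
  [exists c', (c' != c) && (e' == [set child c'; F c'])]) es.
pose A := P (fun F => all (mem (edges (dag F))) es).
have A0 : 0 <= A by apply: Pr_ge0.
(* [other c] reads all coordinates but [c], so [c] can be resampled. *)
have hit c : Ex (@attach_prob R l n)
    (fun F => (e == [set child c; F c])%:R * (other c F)%:R) <=
    c.2.+1%:R^-1 * A.
  rewrite (Ex_upd psum1 c).
  apply: (@le_trans _ _ (Ex (@attach_prob R l n) (fun F => c.2.+1%:R^-1 *
      (all (mem (edges (dag F))) es)%:R))); last by rewrite ExZl.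
  apply: Ex_le_valid => G vG.
  have updE a : other c (upd G c a) = other c G.
    apply: eq_all => e'; congr (_ && _); apply: eq_existsb => c'.
    by rewrite ffunE; case: eqP.
  under eq_bigr do rewrite updE mulrA ffunE eqxx.
  rewrite -mulr_suml; apply: ler_pM => //.
  - by apply: sumr_ge0 => a _; rewrite mulr_ge0.
  - exact: attach_prob_pick.
  rewrite ler_nat; case: (boolP (other c G)) => //= /allP oth.
  rewrite lt0b; apply/allP => e' /oth /andP[e2 /existsP[c' /andP[_ /eqP E]]].
  by apply/dag_edgeP => //; exists c'.
apply: (@le_trans _ _ (Ex (@attach_prob R l n) (fun F =>
    \sum_(c : coord | c.2.+1 == top e)
      (e == [set child c; F c])%:R * (other c F)%:R))).
  apply: Ex_le_valid => F vF; have [/allP allF|] := boolP (all _ _);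
    last by move=> _; apply: sumr_ge0 => c _; rewrite mulr_ge0.
  have /(dag_edgeP _ vF)[c ec] := allF e (mem_head _ _).
  have esF e' : e' \in es -> e' \in edges (dag F).
    by move=> e'es; apply: allF; rewrite inE e'es orbT.
  rewrite (bigD1 c) /=; last by rewrite ec edge_top.
  rewrite {1}ec eqxx mul1r (_ : other c F); last first.
    apply/allP => e' e'es; have := esF _ e'es; rewrite dag_edge.
    case/andP=> -> /existsP[c' /eqP ec']; apply/existsP; exists c'.
    rewrite {1}ec' eqxx andbT; apply: contraNneq ees => cc'.
    by rewrite ec -cc' -ec'.
  by rewrite lerDl; apply: sumr_ge0 => c' _; rewrite mulr_ge0.
rewrite Ex_sum; apply: (@le_trans _ _ (\sum_(c : coord | c.2.+1 == top e)
    (top e)%:R^-1 * A)).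
  by apply: ler_sum => c /eqP <-.
rewrite -mulr_suml; apply: ler_pM (IH ues) => //.
  by apply: sumr_ge0 => c _; rewrite invr_ge0.
rewrite -(pair_big_dep xpredT (fun _ (i : 'I_n) => i.+1 == top e)
  (fun _ _ => (top e)%:R^-1)) /=.
rewrite [leRHS](_ : _ = \sum_(j < l) (top e)%:R^-1); last first.
  by rewrite sumr_const card_ord mulr_natl.
apply: ler_sum => j _.
have [i0 /eqP i0e|noi] := pickP (fun i : 'I_n => i.+1 == top e); last first.
  by rewrite big_pred0 ?invr_ge0.
rewrite (big_pred1 i0) // => i; rewrite -i0e eqSS; exact: val_eqE.
Qed.

Definition walk_edges v p : seq {set V} := pairmap (fun x y => [set x; y]) v p.

(** The shift of the labels costs a factor at most 2, contained in [kernel]. *)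
Lemma prod_walk_edges v p :
  \prod_(e <- walk_edges v p) (l%:R / (top e)%:R) <= walk_weight R l v p.
Proof.
elim: p v => [|x p IH] v /=; first by rewrite big_nil.
rewrite big_cons ler_pM //; first by rewrite mulr_ge0 ?invr_ge0.
  by apply: prodr_ge0 => e _; rewrite mulr_ge0 ?invr_ge0.
rewrite top2 /kernel; case: (maxn v x) => [|m].
  by rewrite invr0 mulr0 mulr_ge0 ?mulr_ge0 ?invr_ge0.
have h : (m.+1%:R : R)^-1 <= 2 * m.+2%:R^-1.
  rewrite ler_pdivlMr ?ltr0n // mulrC ler_pdivrMr ?ltr0n // -natrM ler_nat.
  by lia.
by rewrite -mulrA mulrCA ler_wpM2l.
Qed.

End EdgeProbability.

(** * Confidence sets from rare label-free properties *)

Section Confidence.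
Variable R : realType.

Definition label_invariant (Q : forall n, sgraph n.+1 -> 'I_n.+1 -> bool) :=
  forall n (pi : {perm 'I_n.+1}) (H : sgraph n.+1) v,
    Q n H v -> Q n (relabel pi H) (pi v).

Lemma relabelK n (pi : {perm 'I_n}) (H : sgraph n) :
  relabel pi^-1%g (relabel pi H) = H.
Proof.
apply: val_inj => /=; rewrite -imset_comp -[RHS]imset_id; apply: eq_imset => e /=.
rewrite -imset_comp -[RHS]imset_id; apply: eq_imset => x /=.
by rewrite permK.
Qed.

Lemma label_invariantE Q n (pi : {perm 'I_n.+1}) (H : sgraph n.+1) v :
  label_invariant Q -> Q n (relabel pi H) (pi v) = Q n H v.
Proof.
move=> inv; apply/idP/idP; last exact: inv.
by move/(inv _ pi^-1%g); rewrite relabelK permK.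
Qed.

(** Markov's inequality bounds the probability that more than [K] vertices have
    the property, in which case the empty set is returned. Graphs with at most
    [K] vertices need no estimation. *)
Lemma confidence_of_property (mu : forall n, sgraph n.+1 -> R)
    (Q : forall n, sgraph n.+1 -> 'I_n.+1 -> bool) (eps M : R) (K : nat) :
    (forall n H, 0 <= mu n H) -> (forall n, \sum_H mu n H = 1) ->
    label_invariant Q -> 0 < eps -> (0 < K)%N -> 2 * M <= eps * K%:R ->
    (forall n, (K <= n)%N -> \sum_(H | ~~ Q n H ord0) mu n H <= eps / 2) ->
    (forall n, (K <= n)%N -> \sum_v \sum_(H | Q n H v) mu n H <= M) ->
  confidence_size mu eps K.
Proof.
move=> mu0 mu1 inv eps0 K0 MK rootQ countQ; split=> // n.
have [Kn|nK] := leqP K n; last first.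
  exists (fun=> setT); split.
  - move=> pi H; apply/setP => x; rewrite inE -[x](permKV pi).
    by rewrite mem_imset ?inE //; apply: perm_inj.
  - by move=> H; rewrite cardsT card_ord.
  - under eq_bigl do rewrite inE.
    by rewrite mu1 gerBl ltW.
pose A (H : sgraph n.+1) := [set v | Q n H v].
have A_relabel pi H : A (relabel pi H) = pi @: A H.
  apply/setP => x; rewrite -[x](permKV pi) mem_imset; last exact: perm_inj.
  by rewrite !inE label_invariantE.
exists (fun H => if (#|A H| <= K)%N then A H else set0); split.
- move=> pi H; rewrite A_relabel card_imset; last exact: perm_inj.
  by case: ifP => // _; rewrite imset0.
- by move=> H; case: ifP; rewrite ?cards0.
have big_le : \sum_(H | ~~ (#|A H| <= K)%N) mu n H <= eps / 2.
  have KR0 : 0 < K%:R :> R by rewrite ltr0n.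
  rewrite -(ler_pM2r KR0).
  apply: (@le_trans _ _ M); last by rewrite mulrAC ler_pdivlMr // mulrC.
  apply: le_trans (countQ n Kn).
  rewrite (exchange_big_dep xpredT) //= mulr_suml [leLHS]big_mkcond /=.
  apply: ler_sum => H _; rewrite sumr_const -/(A H).
  rewrite (_ : #|_| = #|A H|); last by apply: eq_card => v; rewrite inE.
  case: ifP => [|_]; last by rewrite mulrn_wge0.
  rewrite -ltnNge => /ltnW KA; rewrite -[leRHS]mulr_natr.
  by rewrite ler_wpM2l // ler_nat.
rewrite lerBlDr -(mu1 n) (bigID (fun H => ord0 \in
  (if (#|A H| <= K)%N then A H else set0))) /= lerD2l.
apply: (@le_trans _ _ (eps / 2 + eps / 2)); last by rewrite -splitr.
apply: le_trans (lerD (rootQ n Kn) big_le).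
rewrite [X in _ <= X + _]big_mkcond [X in _ <= _ + X]big_mkcond -big_split /=.
rewrite big_mkcond; apply: ler_sum => H _.
case: (leqP #|A H| K) => _ /=; rewrite inE.
  by rewrite addr0.
by rewrite /= lerDr; case: ifP.
Qed.

Definition theta_edges n (v : 'I_n.+1) q r p : seq {set 'I_n.+1} :=
  walk_edges v q ++ walk_edges v r ++ walk_edges (last v q) p.

(** [q] and [r] lead from [v] to a vertex [w] and [p] leads back to [v]. As [p]
    may be empty, this covers both theta graphs with branch vertices [v], [w]
    and two cycles through [v = w]. Only edges are required to be distinct,
    which is what [Pr_edges] needs. *)
Definition theta_spec t n (H : sgraph n.+1) (v : 'I_n.+1) : Prop :=
  exists q r p,
    [/\ (0 < size q <= t)%N, (0 < size r <= t)%N & (size p <= t)%N] /\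
    [/\ last v q = last v r, last (last v q) p = v,
        uniq (theta_edges v q r p) &
        all (mem (edges H)) (theta_edges v q r p)].

Definition theta t n (H : sgraph n.+1) v : bool := `[< theta_spec t H v >].

Lemma walk_edges_map n (pi : {perm 'I_n.+1}) v p :
  walk_edges (pi v) (map pi p) =
  [seq pi @: e | e : {set 'I_n.+1} <- walk_edges v p].
Proof.
by elim: p v => //= x p IH v; rewrite IH imsetU1 imset_set1.
Qed.

Lemma theta_label_invariant t : label_invariant (theta t).
Proof.
move=> n pi H v /asboolP[q [r [p [sz [qr pv un inH]]]]]; apply/asboolP.
have E : theta_edges (pi v) (map pi q) (map pi r) (map pi p) =
    [seq pi @: e | e : {set 'I_n.+1} <- theta_edges v q r p].
  by rewrite /theta_edges last_map !walk_edges_map -!map_cat.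
exists (map pi q), (map pi r), (map pi p); rewrite !size_map; split=> //.
rewrite E !last_map qr -qr pv; split=> //.
  by rewrite map_inj_uniq //; apply/imset_inj/perm_inj.
rewrite all_map; apply: sub_all inH => e /= eH.
by rewrite mem_imset //; apply/imset_inj/perm_inj.
Qed.

(** A union bound over the triples of walks. *)
Lemma Pr_theta_sum t l n : (0 < l)%N ->
  \sum_v Pr (@attach_prob R l n) (fun F => theta t (dag F) v)
    <= 3 * t.+1%:R ^+ 3 * (8 * l%:R) ^+ (3 * t).
Proof.
move=> l0; apply: le_trans (sum_theta_weights R n l0 t).
have pge0 := @attach_prob_ge0 R l n; have psum1 := @attach_prob_sum1 R l n.
apply: ler_sum => v _.
pose W1 := walks_range n 1 t; pose W := walks_range n 0 t.+1.
pose L := [seq (q, rp) | q <- W1, rp <- [seq (r, p) | r <- W1, p <- W]].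
pose ok (u : seq 'I_n.+1 * (seq 'I_n.+1 * seq 'I_n.+1))
    (F : {ffun 'I_l * 'I_n -> 'I_n.+1}) :=
  let: (q, (r, p)) := u in
  [&& last v q == last v r, last (last v q) p == v,
      uniq (theta_edges v q r p) &
      all (mem (edges (dag F))) (theta_edges v q r p)].
apply: (@le_trans _ _ (Pr (@attach_prob R l n) (fun F => has (ok^~ F) L))).
  apply: Pr_le_valid => F _ /asboolP[q [r [p [[sq sr sp] [qr pv un inH]]]]].
  apply/hasP; exists (q, (r, p)).
    by rewrite allpairs_f ?allpairs_f ?mem_walks_range ?add1n ?ltnS.
  by rewrite /ok qr -qr pv un inH !eqxx.
apply: (le_trans (Pr_has pge0 _ _)).
rewrite big_allpairs_dep; apply: ler_sum => q _.
rewrite big_allpairs_dep; apply: ler_sum => r _; apply: ler_sum => p _.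
have [/andP[qr pv]|nqr] := boolP (_ && _); last first.
  rewrite mul0r -[leRHS](Ex_cst psum1); apply: Ex_le_valid => F _.
  by rewrite /ok andbA (negbTE nqr).
have [un|nun] := boolP (uniq (theta_edges v q r p)); last first.
  rewrite mul1r (@le_trans _ _ 0) ?mulr_ge0 ?walk_weight_ge0 //.
  rewrite -[leRHS](Ex_cst psum1); apply: Ex_le_valid => F _.
  by rewrite /ok (negbTE nun) !andbF.
apply: (@le_trans _ _ (Pr (@attach_prob R l n)
    (fun F => all (mem (edges (dag F))) (theta_edges v q r p)))).
  by apply: Pr_le_valid => F _ /and4P[].
apply: (le_trans (Pr_edges _ _ un)).
rewrite !big_cat /= mul1r mulrA; apply: ler_pM; rewrite ?prod_walk_edges //.
- by apply: mulr_ge0; apply: prodr_ge0 => e _; rewrite divr_ge0.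
- by apply: prodr_ge0 => e _; rewrite divr_ge0.
by apply: ler_pM; rewrite ?prod_walk_edges //; apply: prodr_ge0 => e _; rewrite divr_ge0.
Qed.

End Confidence.

(** * Subtree sizes as urns *)

Lemma fconnect_iterP (T : finType) (f : T -> T) x y :
  reflect (exists k, iter k f x = y) (fconnect f x y).
Proof.
apply: (iffP idP) => [xy|[k <-]]; last exact: fconnect_iter.
by exists (findex f x y); apply: iter_findex.
Qed.

Lemma fconnect_step (T : finType) (f : T -> T) x y :
  fconnect f x y = (x == y) || fconnect f (f x) y.
Proof.
apply/fconnect_iterP/orP => [[[|k] <-]|[/eqP->|/fconnect_iterP[k <-]]].
- by left; rewrite /= eqxx.
- by right; rewrite iterSr fconnect_iter.
- by exists 0.
- by exists k.+1; rewrite iterSr.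
Qed.

Section Subtrees.
Variables (R : realType) (l n : nat) (j : 'I_l).
Local Notation V := 'I_n.+1.
Local Notation coord := ('I_l * 'I_n)%type.
Local Notation E := (Ex (@attach_prob R l n)).
Local Notation P := (Pr (@attach_prob R l n)).
Implicit Types (F G : {ffun coord -> V}) (x v : V) (i : 'I_n).

Definition below F v x : bool := fconnect (par F j) x v.

(** The size of the subtree of [v] when the vertices below [m] have arrived. *)
Definition subtree_size F v m : nat := #|[set x : V | (x < m)%N && below F v x]|.

Lemma below_ge F v x : valid F -> below F v x -> (v <= x)%N.
Proof. by move=> vF /fconnect_iterP[k <-]; apply: (iter_par_le). Qed.

Lemma below_upd G i a v x : valid G -> (x <= i)%N ->
  below (upd G (j, i) a) v x = below G v x.
Proof.
move=> vG xi; apply/fconnect_iterP/fconnect_iterP => -[k] <-; exists k.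
  by rewrite (iter_par_upd).
by rewrite (iter_par_upd).
Qed.

Lemma subtree_sizeE F v m :
  subtree_size F v m = (\sum_(x : V) ((x < m) && below F v x))%N.
Proof.
rewrite /subtree_size -sum1_card big_mkcond; apply: eq_bigr => x _.
by rewrite inE; case: (_ && _).
Qed.

Lemma subtree_size_self F v : valid F -> subtree_size F v v.+1 = 1%N.
Proof.
move=> vF; rewrite subtree_sizeE (bigD1 v) //= ltnSn /below connect0 big1 //.
move=> x xv; rewrite ltnS; case: leqP => //= xlev; apply/eqP; rewrite eqb0.
apply: contra xv => /(below_ge vF) vx.
by apply/eqP/val_inj/eqP; rewrite /= eqn_leq xlev vx.
Qed.

Lemma subtree_size_upd G i (a v : V) : valid G -> (v <= i)%N -> (a <= i)%N ->
  subtree_size (upd G (j, i) a) v i.+2 =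
  (subtree_size G v i.+1 + below G v a)%N.
Proof.
move=> vG vi ai; rewrite !subtree_sizeE.
rewrite (bigD1 (lift ord0 i)) //= [in RHS](bigD1 (lift ord0 i)) //=.
have -> : (lift ord0 i < i.+2)%N by rewrite lift0.
have -> : (lift ord0 i < i.+1)%N = false by rewrite lift0 ltnn.
rewrite add0n addnC; congr (_ + _)%N; last first.
  rewrite /= -(below_upd a v vG ai) /below fconnect_step par_lift ffunE eqxx.
  by case: eqP => // E; rewrite -E lift0 ltnn in vi.
apply: eq_bigr => x xi; have -> : (x < i.+2)%N = (x < i.+1)%N.
  rewrite ltnS leq_eqVlt; case: eqP => //= xi'; case/eqP: xi.
  by apply: ord_inj; rewrite lift0.
by rewrite ltnS; case: leqP => //= xlei; rewrite below_upd.
Qed.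

(** Polya's urn: the next vertex joins the subtree of [v] with probability equal
    to the current proportion of this subtree. *)
Lemma Ex_urn i v (phi : nat -> R) : (v <= i)%N ->
  E (fun F => phi (subtree_size F v i.+2)) =
  E (fun F => let z := subtree_size F v i.+1 in
       (1 - z%:R / i.+1%:R) * phi z + z%:R / i.+1%:R * phi z.+1).
Proof.
move=> vi; rewrite (Ex_attach j i); apply: Ex_eq_valid => G vG.
set z := subtree_size G v i.+1.
transitivity (\sum_a attach_prob R (j, i) a *
    (phi z + (below G v a)%:R * (phi z.+1 - phi z))).
  apply: eq_bigr => a _.
  have [->|/attach_prob_neq0 ai] := eqVneq (attach_prob R (j, i) a) 0.
    by rewrite !mul0r.
  rewrite subtree_size_upd //; congr (_ * _).
  by case: (below G v a); rewrite ?addn1 ?addn0 ?mul1r ?mul0r ?addr0 // addrC subrK.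
under eq_bigr do rewrite mulrDr mulrA.
rewrite big_split /= -mulr_suml attach_prob_sum1 mul1r -mulr_suml.
rewrite (_ : \sum_a _ = z%:R / i.+1%:R); last first.
  rewrite /z subtree_sizeE natr_sum mulr_suml; apply: eq_bigr => x _.
  by rewrite /attach_prob ltnS mulrAC -natrM mulnb.
ring.
Qed.

(** In the urn, the mean of [z * z.+1] is multiplied by [(m + 2) / m] when the
    vertex [m] arrives; the product of these factors telescopes. *)
Lemma Ex_subtree_size_sq v m : (v < m <= n.+1)%N ->
  E (fun F => (subtree_size F v m)%:R * (subtree_size F v m).+1%:R) =
  2 * m%:R * m.+1%:R / (v.+1%:R * v.+2%:R).
Proof.
elim: m => // m IH /andP[]; rewrite ltnS leq_eqVlt => /predU1P[<- _|vm mn].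
  rewrite (_ : E _ = E (fun=> 2)); last first.
    apply: Ex_eq_valid => F vF.
    by rewrite subtree_size_self // mul1r.
  rewrite (Ex_cst (@attach_prob_sum1 R l n)); field.
  by rewrite nat1r -(natrD _ 2 v) !pnatr_eq0.
case: m IH vm mn => // m IH vm mn.
pose i := Ordinal (mn : (m < n)%N); have vi : (v <= i)%N by [].
rewrite (Ex_urn (i := i) (fun z => z%:R * z.+1%:R) vi) /=.
rewrite (_ : E _ = E (fun F => (m.+3%:R / m.+1%:R) *
    ((subtree_size F v m.+1)%:R * (subtree_size F v m.+1).+1%:R))); last first.
  apply: Ex_ext => F; move: (subtree_size F v m.+1) => z.
  rewrite -(natr1 z.+1) -(natr1 z) -(natr1 m.+2) -(natr1 m.+1) -(natr1 m).
  by field; rewrite natr1 pnatr_eq0.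
rewrite ExZl IH; last by rewrite vm ltnW.
rewrite -(natr1 m.+2) -(natr1 m.+1) -(natr1 v.+1).
by field; rewrite !nat1r natr1 !pnatr_eq0.
Qed.

(** When the second vertex arrives there is one vertex on each side of the edge
    to the root, and Polya's urn started from (1, 1) is uniform at all times. *)
Lemma Pr_subtree_size_unif (v : V) m k : v = 1%N :> nat -> (1 < m <= n.+1)%N ->
  P (fun F => subtree_size F v m == k) = (0 < k < m)%N%:R / m.-1%:R.
Proof.
move=> v1; elim: m k => // m IH k /andP[]; rewrite ltnS leq_eqVlt.
case/predU1P => [<- _|m1 mn].
  rewrite divr1 (_ : P _ = E (fun=> (0 < k < 2)%N%:R)).
    by rewrite (Ex_cst (@attach_prob_sum1 R l n)).
  apply: Ex_eq_valid => F vF.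
  by rewrite -v1 subtree_size_self // v1; case: k => [|[|k]].
case: m IH m1 mn => // m IH m1 mn.
pose i := Ordinal (mn : (m < n)%N); have vi : (v <= i)%N by rewrite v1.
have {}IH k' := IH k' (introT andP (conj m1 (ltnW mn))).
rewrite [LHS](Ex_urn (i := i) (fun z => (z == k)%:R) vi) /=.
case: k => [|k].
  rewrite (_ : E _ = P (fun F => subtree_size F v m.+1 == 0)).
    by rewrite IH !mul0r.
  rewrite [RHS]/Pr; apply: Ex_ext => F.
  case: eqP => [->|_]; rewrite /= ?mulr0 ?addr0 //.
  by rewrite mul0r subr0 mulr1.
rewrite (_ : E _ = E (fun F =>
   (1 - k.+1%:R / m.+1%:R) * (subtree_size F v m.+1 == k.+1)%:R +
   (k%:R / m.+1%:R) * (subtree_size F v m.+1 == k)%:R)); last first.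
  apply: Ex_ext => F; rewrite eqSS.
  by congr (_ + _); case: eqP => [->|_]; rewrite ?mulr0.
rewrite /Pr in IH; rewrite ExD !ExZl !IH /= ltnS.
have m0 : m%:R != 0 :> R by rewrite pnatr_eq0 -lt0n.
have m10 : m.+1%:R != 0 :> R by rewrite pnatr_eq0.
have -> : k%:R / m.+1%:R * ((0 < k <= m)%N%:R / m%:R) =
    (k <= m)%N%:R * (k%:R / m.+1%:R / m%:R) :> R.
  case: (k) => [|k']; first by rewrite !(mul0r, mulr0).
  by rewrite /= mulrA mulrCA !mulrA.
rewrite !ltnS; have [km|km] := ltnP k m.
  rewrite (ltnW km) !mul1r -(natr1 k); rewrite -(natr1 m) in m10 *.
  by field; rewrite m0 m10.
rewrite mul0r mulr0 add0r leq_eqVlt [(k < m)%N]ltnNge km orbF.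
case: eqP => [->|_]; last by rewrite !mul0r.
by rewrite !mul1r; field; rewrite m0 nat1r m10.
Qed.

End Subtrees.

(** * Balanced vertices of a tree *)

Section Centroid.

Definition avoid_adj n (H : sgraph n.+1) (v : 'I_n.+1) : rel 'I_n.+1 :=
  fun a b => [&& a != v, b != v & [set a; b] \in edges H].

Definition branch n (H : sgraph n.+1) (v u : 'I_n.+1) : {set 'I_n.+1} :=
  [set x | connect (avoid_adj H v) u x].

(** Every branch at [v] misses at least a fraction 1/D of the vertices; the
    product form avoids division. *)
Definition balanced D n (H : sgraph n.+1) (v : 'I_n.+1) : bool :=
  [forall u, (u != v) ==> (n.+1 <= D * (n.+1 - #|branch H v u|))%N].

Lemma avoid_adj_relabel n (pi : {perm 'I_n.+1}) (H : sgraph n.+1) v a b :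
  avoid_adj (relabel pi H) (pi v) (pi a) (pi b) = avoid_adj H v a b.
Proof.
rewrite /avoid_adj !(inj_eq perm_inj) -(imset_set1 pi b) -imsetU1.
by rewrite mem_imset //; apply/imset_inj/perm_inj.
Qed.

Lemma connect_map (T T' : finType) (f : T -> T') (e : rel T) (e' : rel T') :
    (forall a b, e a b -> e' (f a) (f b)) ->
  forall a b, connect e a b -> connect e' (f a) (f b).
Proof.
move=> h a b /connectP[p]; elim: p a => [|c p IH] a /= => [_ ->//|].
by case/andP=> /h ac pp bE; apply: connect_trans (connect1 ac) (IH _ pp bE).
Qed.

Lemma branch_relabel n (pi : {perm 'I_n.+1}) (H : sgraph n.+1) v u :
  branch (relabel pi H) (pi v) (pi u) = pi @: branch H v u.
Proof.
apply/setP => x; rewrite -[x](permKV pi) mem_imset; last exact: perm_inj.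
move: (pi^-1%g x) => y; rewrite !inE; apply/idP/idP.
  move=> uy; rewrite -[u](permK pi) -[y](permK pi);
  apply: (connect_map (f := pi^-1%g)) uy => a b.
  by rewrite -(avoid_adj_relabel pi H) !permKV.
by apply: connect_map => a b; rewrite avoid_adj_relabel.
Qed.

Lemma balanced_label_invariant D : label_invariant (balanced D).
Proof.
move=> n pi H v /forallP bal; apply/forallP => u.
rewrite -[u](permKV pi); move: (pi^-1%g u) => w; rewrite branch_relabel.
by rewrite card_imset ?(inj_eq perm_inj) //; apply: perm_inj.
Qed.

Variables (R : realType) (n D : nat).
Local Notation V := 'I_n.+1.
Local Notation P := (Pr (@attach_prob R 1 n)).
Local Notation E := (Ex (@attach_prob R 1 n)).
Local Notation size_below := (subtree_size (ord0 : 'I_1)).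
Implicit Types (F : {ffun 'I_1 * 'I_n -> V}) (v x : V).

(** A branch at the root is contained in the subtree of the second vertex [v] or
    disjoint from it, since leaving this subtree requires to visit the root. *)
Lemma balanced_root F (v : V) : valid F -> v = 1%N :> nat ->
  (n.+1 <= D * size_below F v n.+1)%N ->
  (n.+1 <= D * (n.+1 - size_below F v n.+1))%N ->
  balanced D (dag F) ord0.
Proof.
move=> vF v1 big1 big2; apply/forall_inP => u u0.
have zE : size_below F v n.+1 = #|[set x | below ord0 F v x]|.
  by apply: eq_card => x; rewrite !inE ltn_ord.
have cl : closed (avoid_adj (dag F) ord0) [set x | below ord0 F v x].
  have step a : a != ord0 -> par F ord0 a != ord0 ->
      below ord0 F v a = below ord0 F v (par F ord0 a).
    move=> a0 b0; rewrite /below fconnect_step; case: eqP => // E.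
    rewrite E in a0 b0 *; have := par_lt ord0 vF a0; rewrite v1 ltnS leqn0.
    by move=> /eqP p0; case/eqP: b0; apply: ord_inj.
  move=> a b /and3P[a0 b0 ab]; rewrite !inE.
  have [->//|nab] := eqVneq a b.
  have [j] := edge_par vF ab nab; rewrite (ord1 j) => -[[_ h]|[_ h]].
    by rewrite h in b0 *; apply: step.
  by rewrite h in a0 *; apply/esym/step.
have [uv|uv] := boolP (below ord0 F v u).
  apply: (leq_trans big2); rewrite leq_mul2l leq_sub2l ?orbT // zE.
  apply/subset_leq_card/subsetP => x; rewrite !inE => /(closed_connect cl).
  by rewrite !inE uv => <-.
apply: (leq_trans big1); rewrite leq_mul2l; apply/orP; right.
have compl : (#|[set x | below ord0 F v x]| + #|~: [set x | below ord0 F v x]|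
    = n.+1)%N by rewrite cardsC card_ord.
rewrite zE; suff : (#|branch (dag F) ord0 u| <=
    #|~: [set x | below ord0 F v x]|)%N by lia.
apply/subset_leq_card/subsetP => x; rewrite !inE.
by move/(closed_connect cl); rewrite !inE (negbTE uv) => <-.
Qed.

(** The vertices outside the subtree of [v] reach the root without meeting [v],
    so they lie in a single branch at [v]. *)
Lemma balanced_below F v : valid F -> v != ord0 -> balanced D (dag F) v ->
  (n.+1 <= D * size_below F v n.+1)%N.
Proof.
move=> vF v0 /forall_inP/(_ ord0); rewrite eq_sym v0 => /(_ isT) bal.
apply: (leq_trans bal); rewrite leq_mul2l; apply/orP; right.
have zE : size_below F v n.+1 = #|[set x | below ord0 F v x]|.
  by apply: eq_card => x; rewrite !inE ltn_ord.
have compl : (#|[set x | below ord0 F v x]| + #|~: [set x | below ord0 F v x]|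
    = n.+1)%N by rewrite cardsC card_ord.
rewrite zE; suff : (#|~: [set x | below ord0 F v x]| <=
    #|branch (dag F) v ord0|)%N by lia.
apply/subset_leq_card/subsetP => x.
elim/ltn_ind: {x}(x : nat) {-2}x (erefl (x : nat)) => m IH x xm.
rewrite !inE => nbx; have [->|x0] := eqVneq x ord0; first exact: connect0.
have xv : x != v by apply: contraNneq nbx => ->; apply: connect0.
move: nbx; rewrite /below fconnect_step negb_or xv /= => nbp.
have pv : par F ord0 x != v.
  by apply: contraNneq nbp => ->; apply: connect0.
have /IH : (par F ord0 x < m)%N by rewrite -xm par_lt.
move=> /(_ (par F ord0 x) erefl); rewrite !inE => /(_ nbp) c0.
apply: connect_trans c0 (connect1 _).
by rewrite /avoid_adj pv xv setUC par_edge.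
Qed.

End Centroid.

(** * Confidence sets for one tree *)

Section TreeCase.
Variables (R : realType) (n D : nat).
Hypothesis D_gt0 : (0 < D)%N.
Local Notation V := 'I_n.+1.
Local Notation P := (Pr (@attach_prob R 1 n)).
Local Notation E := (Ex (@attach_prob R 1 n)).
Local Notation size_below := (subtree_size (ord0 : 'I_1)).
Implicit Types (F : {ffun 'I_1 * 'I_n -> V}) (v x : V).

Lemma count_small N B : (0 < B)%N ->
  (D * \sum_(0 <= k < N) ((0 < k) && (D * k < B)) < B)%N.
Proof.
move=> B0; suff /andP[] : (\sum_(0 <= k < N) ((0 < k) && (D * k < B)) <= N.-1)%N &&
  (D * \sum_(0 <= k < N) ((0 < k) && (D * k < B)) < B)%N by [].
(* When N is counted, at most N - 1 terms were counted before, whence S + 1 <= N. *)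
elim: N => [|N /andP[IH1 IH2]]; first by rewrite big_geq //= muln0.
rewrite big_nat_recr //=; set S := (\sum_(0 <= k < N) _)%N in IH1 IH2 *.
case: (posnP N) IH1 => [->|N0] IH1.
  by rewrite addn0 IH2 andbT; move: IH1.
have [DN|_] := ltnP (D * N) B; last by rewrite addn0 IH2 andbT; lia.
have SN : (S + 1 <= N)%N by lia.
by rewrite SN /=; apply: leq_ltn_trans DN; rewrite leq_mul2l SN orbT.
Qed.

Lemma sum_small : (0 < n)%N ->
  \sum_(0 <= k < n.+1) ((0 < k < n.+1) && (D * k < n.+1))%N%:R / n%:R
    <= D%:R^-1 :> R.
Proof.
move=> n0; rewrite -mulr_suml ler_pdivrMr ?ltr0n // ler_pdivlMl ?ltr0n //.
rewrite -natr_sum -natrM ler_nat -ltnS.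
apply: leq_ltn_trans (count_small n.+1 (ltn0Sn n)).
rewrite leq_mul2l; apply/orP; right; apply: leq_sum => k _.
by case: (0 < k)%N => //=; case: (k < n.+1)%N.
Qed.

(** Both the subtree of the second vertex and its complement have uniform size,
    and each is smaller than [n.+1 / D] with probability at most [1 / D]. *)
Lemma Pr_unbalanced_root :
  P (fun F => ~~ balanced D (dag F) ord0) <= 2 / D%:R.
Proof.
have [n0|n0] := posnP n.
  rewrite (@le_trans _ _ 0) ?divr_ge0 //.
  rewrite -[leRHS](Ex_cst (@attach_prob_sum1 R 1 n)); apply: Ex_le_valid => F _.
  suff -> : balanced D (dag F) ord0 by [].
  apply/forall_inP => u; case/eqP; apply: ord_inj.
  by have := ltn_ord u; rewrite {2}n0; case: (nat_of_ord u).
pose v : V := inord 1; have v1 : v = 1%N :> nat by rewrite inordK.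
pose z F := size_below F v n.+1.
have zP k : E (fun F => (z F == k)%:R) = (0 < k < n.+1)%N%:R / n%:R.
  rewrite -(Pr_subtree_size_unif R (ord0 : 'I_1) (m := n.+1) k v1) //.
  by rewrite ltnS n0 leqnn.
have zle F : (z F <= n.+1)%N by rewrite -[X in (_ <= X)%N]card_ord max_card.
apply: (@le_trans _ _ (P (fun F => (D * z F < n.+1)%N) +
    P (fun F => (D * (n.+1 - z F) < n.+1)%N))).
  apply: le_trans (PrU (@attach_prob_ge0 R 1 n) _ _).
  apply: Pr_le_valid => F vF; apply: contraR; rewrite negb_or -!leqNgt.
  by case/andP; apply: balanced_root.
rewrite mulrDl mul1r; apply: lerD; apply: le_trans (sum_small n0).
  apply: (@le_trans _ _ (\sum_(0 <= k < n.+1)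
      E (fun F => (D * k < n.+1)%N%:R * (z F == k)%:R))).
    rewrite -Ex_sum; apply: Ex_le_valid => F _.
    rewrite big_mkord; case: ltnP => zD; last by apply: sumr_ge0 => k _; rewrite mulr_ge0.
    have zn : (z F < n.+1)%N by apply: leq_ltn_trans zD; apply: leq_pmull.
    rewrite (bigD1 (Ordinal zn)) //= zD eqxx mulr1 lerDl sumr_ge0 // => k _.
    by rewrite mulr_ge0.
  apply: ler_sum => k _; rewrite ExZl zP mulrA -natrM mulnb.
  by rewrite andbC.
apply: (@le_trans _ _ (\sum_(0 <= k < n.+1)
    E (fun F => (D * k < n.+1)%N%:R * (z F == n.+1 - k)%N%:R))).
  rewrite -Ex_sum; apply: Ex_le_valid => F _.
  rewrite big_mkord; case: ltnP => zD; last by apply: sumr_ge0 => k _; rewrite mulr_ge0.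
  have zn : (n.+1 - z F < n.+1)%N by apply: leq_ltn_trans zD; apply: leq_pmull.
  rewrite (bigD1 (Ordinal zn)) //= zD subKn // eqxx mulr1 lerDl sumr_ge0 // => k _.
  by rewrite mulr_ge0.
rewrite !big_mkord; apply: ler_sum => k _; rewrite ExZl zP mulrA -natrM mulnb.
rewrite ler_wpM2r ?invr_ge0 // ler_nat.
have := ltn_ord k; case: (_ < _)%N => //=; rewrite ?andbT; lia.
Qed.

(** Markov's inequality for the second moment of the subtree size, whose
    decay in [v] is quadratic and hence summable. *)
Lemma Pr_balanced v : P (fun F => balanced D (dag F) v) <=
  4 * D%:R ^+ 2 / (v.+1%:R * v.+2%:R).
Proof.
have [->|v0] := eqVneq v ord0.
  apply: (le_trans (Pr_le1 (@attach_prob_ge0 R 1 n) (@attach_prob_sum1 R 1 n) _)).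
  have D2 : (0 < D ^ 2)%N by rewrite expn_gt0 D_gt0.
  by rewrite -natrX -!natrM ler_pdivlMr ?ltr0n // mul1r ler_nat /=; lia.
have N0 : 0 < n.+1%:R :> R by rewrite ltr0n.
apply: (@le_trans _ _ (E (fun F => D%:R ^+ 2 / n.+1%:R ^+ 2 *
   ((size_below F v n.+1)%:R * (size_below F v n.+1).+1%:R)))).
  apply: Ex_le_valid => F vF; case: (boolP (balanced _ _ _)) => [bal|_]; last first.
    by rewrite mulr_ge0 ?divr_ge0 ?exprn_ge0 ?mulr_ge0.
  have := balanced_below vF v0 bal; set z := size_below F v n.+1 => zD.
  rewrite mulrAC ler_pdivlMr ?exprn_gt0 // mul1r -!natrX -!natrM ler_nat; nia.
rewrite ExZl Ex_subtree_size_sq ?ltn_ord ?leqnn //.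
rewrite [leLHS]mulrA ler_wpM2r ?invr_ge0 ?mulr_ge0 //.
rewrite [leLHS](_ : _ = (2 * n.+2%:R / n.+1%:R) * D%:R ^+ 2); last first.
  by field; rewrite nat1r pnatr_eq0.
rewrite ler_wpM2r ?exprn_ge0 // ler_pdivrMr // -!natrM ler_nat; lia.
Qed.

Lemma sum_inv_consecutive N :
  \sum_(0 <= k < N) (k.+1%:R * k.+2%:R)^-1 = 1 - N.+1%:R^-1 :> R.
Proof.
elim: N => [|N IH]; first by rewrite big_geq // invr1 subrr.
rewrite big_nat_recr //= IH -(natr1 N.+1); field.
by rewrite !nat1r natr1 !pnatr_eq0.
Qed.

Lemma Pr_balanced_sum :
  \sum_v P (fun F => balanced D (dag F) v) <= 4 * D%:R ^+ 2.
Proof.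
apply: (@le_trans _ _ (\sum_(v : V) 4 * D%:R ^+ 2 / (v.+1%:R * v.+2%:R))).
  by apply: ler_sum => v _; apply: Pr_balanced.
rewrite -mulr_sumr -(big_mkord xpredT (fun k => (k.+1%:R * k.+2%:R : R)^-1)).
rewrite sum_inv_consecutive -[leRHS]mulr1 ler_wpM2l ?mulr_ge0 ?exprn_ge0 //.
by rewrite gerBl invr_ge0.
Qed.

End TreeCase.

Lemma tree_confidence (R : realType) (D K : nat) (eps : R) :
    (0 < D)%N -> 4 / eps <= D%:R -> 0 < eps -> (0 < K)%N ->
    8 * D%:R ^+ 2 <= eps * K%:R ->
  confidence_size (@recursive_dag_pmf R 1) eps K.
Proof.
move=> D0 De eps0 K0 DK.
apply: (@confidence_of_property R _ (balanced D) eps (4 * D%:R ^+ 2)) => //.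
- exact: recursive_dag_pmf_ge0.
- exact: recursive_dag_pmf_sum1.
- exact: balanced_label_invariant.
- by apply: le_trans DK; rewrite mulrA -natrM.
- move=> n _; rewrite (sum_recursive_dag_pmf R 1 (fun H => ~~ balanced D H ord0)).
  apply: (le_trans (Pr_unbalanced_root _ _ D0)).
  rewrite ler_pdivrMr ?ltr0n //; move: De; rewrite ler_pdivrMr //; lra.
- move=> n _; apply: le_trans (Pr_balanced_sum R n D0).
  apply: ler_sum => v _.
  by rewrite (sum_recursive_dag_pmf R 1 (fun H => balanced D H v)).
Qed.

(** * A theta through the root *)

Section ThetaAtRoot.
Variables (l n : nat).
Local Notation V := 'I_n.+1.
Implicit Types (F : {ffun 'I_l * 'I_n -> V}) (j a b : 'I_l) (x y w : V).

Lemma walk_edges_traject j F x k :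
  walk_edges x (traject (par F j) (par F j x) k) =
  [seq [set y; par F j y] | y <- traject (par F j) x k].
Proof. by elim: k x => //= k IH x; rewrite IH. Qed.

Lemma top_par F j y : valid F -> top [set y; par F j y] = y.
Proof. by move=> vF; rewrite top2; apply/maxn_idPl/par_le. Qed.

Lemma traject_uniq F j x k : valid F ->
  {in traject (par F j) x k, forall y, y != ord0} -> uniq (traject (par F j) x k).
Proof.
move=> vF; elim: k x => //= k IH x nz; rewrite IH ?andbT; last first.
  by move=> y yk; apply: nz; rewrite inE yk orbT.
apply/negP => /trajectP[i _ E].
have := par_lt j vF (nz x (mem_head _ _)).
by rewrite ltnNge {1}E iter_par_le.
Qed.

(** Let [w] be the first vertex of the path from [x2] to the root in the tree [b]
    that lies on the path from [x1]. The three walks are the path from [w] to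
    the root, and the two paths from the root through [x1], resp. [x2], to [w].
    An edge of the tree [b] is determined by its younger endpoint, so that these
    edges are distinct because the three pieces of path are disjoint; the edges
    from the root to [x1] and [x2] are not in the tree [b]. *)
Lemma theta_at_root F a b x1 x2 d : valid F -> x1 != x2 ->
    x1 != ord0 -> x2 != ord0 -> par F a x1 = ord0 -> par F a x2 = ord0 ->
    par F b x1 != ord0 -> par F b x2 != ord0 ->
    iter d (par F b) x1 = ord0 -> iter d (par F b) x2 = ord0 ->
  theta d.+1 (dag F) ord0.
Proof.
move=> vF x12 x10 x20 a1 a2.
have [f fE] : exists f, f = par F b by exists (par F b).
rewrite -fE => b1 b2 d1P d2P.
have ex1 : exists k, iter k f x1 == ord0 by exists d; apply/eqP.
case: (ex_minnP ex1) => d1 /eqP d10 d1min.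
have d1d : (d1 <= d)%N by apply: d1min; apply/eqP.
have nz1 : {in traject f x1 d1, forall y, y != ord0}.
  move=> y /trajectP[i id1 ->]; apply/negP => /d1min.
  by rewrite leqNgt id1.
have in0 : ord0 \in traject f x1 d1.+1 by apply/trajectP; exists d1.
have ex2 : exists k, iter k f x2 \in traject f x1 d1.+1 by exists d; rewrite d2P.
case: (ex_minnP ex2) => k3 /trajectP[k2 k2d1 wE] k3min.
have k3d : (k3 <= d)%N by apply: k3min; rewrite d2P.
have out3 : {in traject f x2 k3, forall y, y \notin traject f x1 d1.+1}.
  move=> y /trajectP[i ik ->]; apply/negP => /k3min.
  by rewrite leqNgt ik.
have nz3 : {in traject f x2 k3, forall y, y != ord0}.
  by move=> y /out3; apply: contraNneq => ->.
rewrite ltnS in k2d1; pose k1 := (d1 - k2)%N.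
have d1E : d1 = (k2 + k1)%N by rewrite subnKC.
pose w := iter k2 f x1; pose E y := [set y; f y].
have edgesE : theta_edges ord0 (x1 :: traject f (f x1) k2)
    (x2 :: traject f (f x2) k3) (traject f (f w) k1) =
  ([set ord0; x1] :: map E (traject f x1 k2)) ++
  ([set ord0; x2] :: map E (traject f x2 k3)) ++ map E (traject f w k1).
  by rewrite /theta_edges /= last_traject -/w /E fE !walk_edges_traject.
apply/asboolP; exists (x1 :: traject f (f x1) k2), (x2 :: traject f (f x2) k3),
  (traject f (f w) k1); split.
  split; rewrite /= size_traject ?ltnS ?(leq_trans k2d1) //.
  exact: leq_trans (leq_subr _ _) (leqW d1d).
split.
- by rewrite /= !last_traject wE.
- by rewrite /= !last_traject /w -iterD addnC -d1E.
(* The two edges at the root come first, the two pieces of the path from x1 are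
   joined; uniqueness is then read on younger endpoints. *)
- rewrite edgesE; set es := _ ++ _; have pE : perm_eq es
      ([set ord0; x1] :: [set ord0; x2] ::
        map E (traject f x1 d1 ++ traject f x2 k3)).
    apply/seq.permP => P; rewrite /es d1E trajectD /= !map_cat !count_cat /=.
    by rewrite -/w !count_cat; lia.
  have nz13 : {in traject f x1 d1 ++ traject f x2 k3, forall y, y != ord0}.
    by move=> y; rewrite mem_cat => /orP[/nz1|/nz3].
  have notE x : x != ord0 -> f x != ord0 ->
      [set ord0; x] \notin map E (traject f x1 d1 ++ traject f x2 k3).
    move=> x0 fx0; apply/mapP => -[y /nz13 y0 xE].
    have yx : y = x.
      by apply: ord_inj; rewrite -(top_par b y vF) -fE -/(E y) -xE top2 max0n.
    have := set21 ord0 x; rewrite xE yx !inE ![ord0 == _]eq_sym.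
    by rewrite (negbTE x0) (negbTE fx0).
  rewrite (perm_uniq pE) /= inE negb_or !notE // !andbT; apply/andP; split.
    apply/eqP => /(congr1 (@top n)); rewrite !top2 !max0n => /ord_inj.
    exact/eqP.
  rewrite map_inj_in_uniq.
    rewrite cat_uniq fE !traject_uniq -?fE //= andbT; apply/hasPn => y /out3.
    by rewrite trajectSr mem_rcons inE negb_or => /andP[].
  move=> y z _ _ /(congr1 (@top n)); rewrite /E fE !top_par // => yz.
  exact: ord_inj.
have inH s e : {in s, forall y, y != ord0} -> e \in map E s -> e \in edges (dag F).
  by move=> nz /mapP[y /nz y0 ->]; rewrite /E fE; apply: par_edge.
have nz12 : {in traject f x1 k2 ++ traject f w k1, forall y, y != ord0}.
  by rewrite -trajectD -d1E.
rewrite edgesE; apply/allP => e.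
rewrite !(mem_cat, inE) -!orbA => /or4P[/eqP->|eC|/eqP->|/orP[eC|eC]].
- by rewrite -{1}a1 setUC; apply: par_edge.
- by apply: inH eC => y yC; apply: nz12; rewrite mem_cat yC.
- by rewrite -{1}a2 setUC; apply: par_edge.
- exact: inH eC.
- by apply: inH eC => y yC; apply: nz12; rewrite mem_cat yC orbT.
Qed.

End ThetaAtRoot.

(** * Two cycles at the root are likely *)

Section NumericProducts.
Variable R : realFieldType.

Lemma bernoulli (y : R) k : 0 <= y -> 1 + k%:R * y <= (1 + y) ^+ k.
Proof.
move=> y0; elim: k => [|k IH]; first by rewrite mul0r addr0.
rewrite exprS; apply: le_trans (ler_wpM2l _ IH); last by rewrite addr_ge0.
rewrite -natr1; have : 0 <= k%:R :> R by []; nra.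
Qed.

(** The product decreases like [m^(-1/8)]: by Bernoulli's inequality
    (1 - y)^8 <= 1 / (1 + 8 y), and for y = 1 / (8 k) the right-hand sides
    k / (k + 1) telescope. *)
Lemma prod_sub_inv8 m :
  (\prod_(1 <= k < m.+1) (1 - (8 * k%:R)^-1) : R) ^+ 8 <= m.+1%:R^-1.
Proof.
elim: m => [|m IH]; first by rewrite big_geq // expr1n invr1.
rewrite big_nat_recr //= exprMn; set y : R := (8 * m.+1%:R)^-1.
have m0 : 0 < m.+1%:R :> R by rewrite ltr0n.
have y0 : 0 <= y by rewrite invr_ge0 mulr_ge0.
have y1 : y <= 1 by rewrite invf_le1 ?mulr_gt0 // -natrM ler1n.
have h : (1 - y) ^+ 8 <= (1 + 8 * y)^-1.
  have p0 : 0 < 1 + 8 * y by rewrite ltr_wpDr // mulr_ge0.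
  rewrite -[leRHS]mul1r ler_pdivlMr //.
  apply: le_trans (ler_wpM2l _ (bernoulli 8 y0)) _.
    by rewrite exprn_ge0 // subr_ge0.
  rewrite -exprMn exprn_ile1 //; nra.
apply: le_trans (ler_pM _ _ IH h) _; first by rewrite exprn_even_ge0.
  by rewrite exprn_even_ge0.
rewrite /y le_eqVlt; apply/predU1P; left.
rewrite -(natr1 m.+1); field.
by rewrite nat1r natr1 !pnatr_eq0.
Qed.

End NumericProducts.

Section RootThetaProbability.
Variables (R : realType) (l n : nat).
Local Notation V := 'I_n.+1.
Local Notation coord := ('I_l * 'I_n)%type.
Local Notation E := (Ex (@attach_prob R l n)).
Local Notation P := (Pr (@attach_prob R l n)).
Implicit Types (F G : {ffun coord -> V}) (a b j : 'I_l) (i : 'I_n) (X : seq 'I_n).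

Lemma Pr_attach_root c : P (fun F => F c == ord0) = c.2.+1%:R^-1.
Proof.
rewrite /Pr (Ex_coord (@attach_prob_sum1 R l n) c (fun v => (v == ord0)%:R)).
rewrite (bigD1 ord0) //= mulr1 big1 ?addr0 => [|v /negbTE ->]; last by rewrite mulr0.
by rewrite /attach_prob mul1r.
Qed.

(** The vertex [i.+1] hangs from the root in the tree [a] but not in the tree
    [b]: its edge to the root closes a cycle with its path in the tree [b]. *)
Definition closes a b i F := (F (a, i) == ord0) && (F (b, i) != ord0).

Lemma Pr_closes a b i : a != b ->
  P (closes a b i) = i.+1%:R^-1 * (1 - i.+1%:R^-1).
Proof.
move=> ab; rewrite (Pr_indep (@attach_prob_sum1 R l n) (A := [set (a, i)])
    (P := fun F => F (a, i) == ord0) (Q := fun F => F (b, i) != ord0)).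
- by rewrite (PrC (@attach_prob_sum1 R l n)) !Pr_attach_root.
- by move=> F G; rewrite !ffunE set11.
- move=> F G; rewrite !ffunE inE xpair_eqE [b == a]eq_sym.
  by rewrite (negbTE ab).
Qed.

Lemma Pr_none_closes a b X : a != b -> uniq X ->
  P (fun F => all (fun i => ~~ closes a b i F) X) =
  \prod_(i <- X) (1 - i.+1%:R^-1 * (1 - i.+1%:R^-1)).
Proof.
move=> ab; elim: X => [_|i X IH /andP[iX uX]].
  by rewrite big_nil /Pr (Ex_cst (@attach_prob_sum1 R l n)).
rewrite big_cons -(Pr_closes i ab) -IH // -(PrC (@attach_prob_sum1 R l n)).
rewrite -(Pr_indep (@attach_prob_sum1 R l n) (A := [set c | c.2 == i])
    (P := fun F => ~~ closes a b i F)
    (Q := fun F => all (fun i => ~~ closes a b i F) X)) //.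
- by move=> F G; rewrite /closes !ffunE !inE eqxx.
- move=> F G; apply: eq_in_all => i' i'X; rewrite /closes !ffunE !inE /=.
  have /negbTE -> // : i' != i by apply: contraNneq iX => <-.
Qed.

Variable u : nat.
Let m := (2 ^ (8 * u)).-1.
Hypothesis mn : (2 * m < n)%N.
(** Indices are clamped to ['I_n]; they never exceed [2 * m] below. *)
Let vertex k : 'I_n := insubd (Ordinal (leq_ltn_trans (leq0n _) mn)) k.
(** Two disjoint lists of candidates, so that one vertex found in each of them
    makes two distinct vertices. *)
Definition odd_candidates := [seq vertex (2 * k).-1 | k <- iota 1 m].
Definition even_candidates := [seq vertex (2 * k) | k <- iota 1 m].

Lemma vertexK k : (k <= 2 * m)%N -> vertex k = k :> nat.
Proof. by move=> km; rewrite val_insubd (leq_ltn_trans km). Qed.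

Lemma odd_candidatesP i : i \in odd_candidates -> odd i && (i <= 2 * m)%N.
Proof.
case/mapP => k; rewrite mem_iota => kP ->; rewrite vertexK; last by lia.
by case: k kP => [|k] kP; rewrite // mulnS /= oddM /=; lia.
Qed.

Lemma even_candidatesP i : i \in even_candidates -> ~~ odd i && (i <= 2 * m)%N.
Proof.
case/mapP => k; rewrite mem_iota => kP ->; rewrite vertexK; last by lia.
by rewrite oddM /=; lia.
Qed.

(** The vertex [x = (g k).+1] is [2 k] or [2 k + 1] and closes a cycle with
    probability [(x - 1) / x^2], which is at least [1 / (8 k)]. *)
Lemma Pr_none_closes_seq a b (g : nat -> nat) : a != b ->
    (forall k, (0 < k <= m)%N -> (2 * k <= (g k).+1 <= (2 * k).+1)%N) ->
  P (fun F => all (fun i => ~~ closes a b i F) [seq vertex (g k) | k <- iota 1 m])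
    <= (2 ^+ u)^-1.
Proof.
move=> ab gP.
have gm k : k \in iota 1 m -> (g k <= 2 * m)%N.
  by rewrite mem_iota => km; have := gP k; lia.
rewrite Pr_none_closes //; last first.
  rewrite map_inj_in_uniq ?iota_uniq // => k k' km km' /(congr1 (@nat_of_ord n)).
  rewrite !vertexK ?gm //; move: km km'; rewrite !mem_iota => km km'.
  by have := gP k; have := gP k'; lia.
rewrite big_map.
apply: (@le_trans _ _ (\prod_(1 <= k < m.+1) (1 - (8 * k%:R)^-1))).
  rewrite /index_iota subSS subn0 big_seq [leRHS]big_seq.
  apply: ler_prod => k km; rewrite vertexK ?gm //.
  move: km; rewrite mem_iota => km.
  have {}gP : (2 * k <= (g k).+1 <= (2 * k).+1)%N by apply: gP; lia.
  have y0 : 0 < (g k).+1%:R :> R by rewrite ltr0n.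
  have k0 : 0 < 8 * k%:R :> R by rewrite mulr_gt0 // ltr0n; lia.
  have -> : (g k).+1%:R^-1 * (1 - (g k).+1%:R^-1) = (g k)%:R / (g k).+1%:R ^+ 2 :> R.
    by rewrite -natr1; field; rewrite natr1 gt_eqF.
  apply/andP; split.
    rewrite subr_ge0 ler_pdivrMr ?exprn_gt0 // mul1r -natrX ler_nat; nia.
  rewrite lerB // ler_pdivlMr ?exprn_gt0 // mulrC ler_pdivrMr //.
  rewrite -natrX -!natrM ler_nat.
  have [E|E] : ((g k).+1 = 2 * k \/ (g k).+1 = (2 * k).+1)%N by lia.
    by nia.
  by nia.
have := prod_sub_inv8 R m; rewrite /m prednK ?expn_gt0 // => h.
rewrite -(@ler_pXn2r _ 8) ?nnegrE ?invr_ge0 ?exprn_ge0 //.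
  by apply: le_trans h _; rewrite exprVn -exprM mulnC natrX.
rewrite big_seq; apply: prodr_ge0 => k; rewrite mem_index_iota => /andP[k0 _].
rewrite subr_ge0 invf_le1 -?natrM ?ltr0n ?ler1n; lia.
Qed.

(** The union bound over the candidates costs [4 * 2 ^ (16 * u)], which leaves
    [2 ^ u]. *)
Definition depth := (17 * u + 2)%N.

Definition deep b i F := iter depth (par F b) (lift ord0 i) != ord0.

Definition pair_fails a b F :=
  [|| all (fun i => ~~ closes a b i F) odd_candidates,
      all (fun i => ~~ closes a b i F) even_candidates |
      has (fun i => deep b i F) (odd_candidates ++ even_candidates)].

Lemma Pr_deep b :
  P (fun F => has (fun i => deep b i F) (odd_candidates ++ even_candidates))
    <= (2 ^+ u)^-1.
Proof.
have mE : m.+1 = (2 ^ (8 * u))%N by rewrite prednK // expn_gt0.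
apply: (le_trans (Pr_has (@attach_prob_ge0 R l n) _ _)).
apply: (@le_trans _ _ (\sum_(i <- odd_candidates ++ even_candidates)
    (2 * m.+1)%:R / 2 ^+ depth)).
  rewrite big_seq [leRHS]big_seq; apply: ler_sum => i iX.
  apply: (le_trans (Pr_depth R b _ _)); rewrite lift0.
  rewrite ler_wpM2r ?invr_ge0 ?exprn_ge0 // ler_nat.
  have : (i <= 2 * m)%N.
    by move: iX; rewrite mem_cat => /orP[/odd_candidatesP|/even_candidatesP] /andP[].
  by lia.
rewrite big_const_seq count_predT size_cat !size_map size_iota.
rewrite -Monoid.iteropE -[iterop _ _ _ _]/(_ *+ _) -mulr_natl.
rewrite mulrA -natrM ler_pdivrMr ?exprn_gt0 //.
rewrite ler_pdivlMl ?exprn_gt0 // -!natrX -natrM ler_nat.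
have -> : (2 ^ depth = 2 ^ u * (4 * (m.+1 * m.+1)))%N.
  by rewrite mE /depth -!expnD -[4%N]/(2 ^ 2)%N -!expnD; congr (_ ^ _)%N; lia.
by rewrite leq_mul2l; apply/orP; right; nia.
Qed.

Lemma Pr_pair_fails a b : a != b -> P (pair_fails a b) <= 3 / 2 ^+ u.
Proof.
move=> ab; have ge0 := @attach_prob_ge0 R l n.
apply: (le_trans (PrU ge0 _ _)).
rewrite (_ : 3 / _ = (2 ^+ u)^-1 + ((2 ^+ u)^-1 + (2 ^+ u)^-1)); last by ring.
apply: lerD.
  by apply: (Pr_none_closes_seq (g := fun k => (2 * k).-1)) => // k; lia.
apply: (le_trans (PrU ge0 _ _)); apply: lerD; last exact: Pr_deep.
by apply: (Pr_none_closes_seq (g := fun k => (2 * k)%N)) => // k; lia.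
Qed.

Lemma pair_fails_splice a b (A : {set coord}) F G :
    (forall i, ((a, i) \in A) && ((b, i) \in A)) ->
  pair_fails a b (splice A F G) = pair_fails a b F.
Proof.
move=> AP; have aE i : splice A F G (a, i) = F (a, i).
  by rewrite ffunE; case/andP: (AP i) => ->.
have bE i : splice A F G (b, i) = F (b, i).
  by rewrite ffunE; case/andP: (AP i) => _ ->.
rewrite /pair_fails /closes; congr [|| _, _ | _].
- by apply: eq_all => i; rewrite aE bE.
- by apply: eq_all => i; rewrite aE bE.
apply: eq_has => i; rewrite /deep; congr (_ != _); apply: eq_iter => x.
by rewrite /par; case: unliftP.
Qed.

Lemma pair_fails_spliceC a b (A : {set coord}) F G :
    (forall i, ((a, i) \notin A) && ((b, i) \notin A)) ->
  pair_fails a b (splice A F G) = pair_fails a b G.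
Proof.
move=> AP; rewrite -(@pair_fails_splice a b (~: A) G F); last first.
  by move=> i; rewrite !inE.
congr pair_fails; apply/ffunP => c; rewrite !ffunE inE.
by case: (c \in A).
Qed.

Lemma pair_fails_theta a b F : valid F -> ~~ pair_fails a b F ->
  theta depth.+1 (dag F) ord0.
Proof.
move=> vF; rewrite /pair_fails !negb_or.
case/and3P=> /allPn[i iX /negPn /andP[/eqP ai bi]].
move=> /allPn[i' iX' /negPn /andP[/eqP ai' bi']] /hasPn dp.
apply: (theta_at_root (a := a) (b := b) (x1 := lift ord0 i) (x2 := lift ord0 i'));
  rewrite ?par_lift //.
- rewrite (inj_eq lift_inj); apply: contraTneq (odd_candidatesP iX) => ->.
  by case/andP: (even_candidatesP iX') => /negbTE ->.
- by apply/eqP/negPn/dp; rewrite mem_cat iX.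
- by apply/eqP/negPn/dp; rewrite mem_cat iX' orbT.
Qed.

(** The event [pair_fails] reads the coordinates of two trees only, so that it is
    independent for disjoint pairs of trees. *)
Lemma Pr_pairs_fail (a b : nat -> 'I_l) (s : seq nat) :
    (forall k, k \in s -> a k = (2 * k)%N :> nat /\ b k = (2 * k).+1 :> nat) ->
    uniq s ->
  P (fun F => all (fun k => pair_fails (a k) (b k) F) s)
    <= (3 / 2 ^+ u) ^+ size s.
Proof.
elim: s => [|k s IH] ab.
  by move=> _; apply: Pr_le1; [apply: attach_prob_ge0 | apply: attach_prob_sum1].
case/andP=> ks us; have [ak bk] := ab k (mem_head _ _).
rewrite (Pr_indep (@attach_prob_sum1 R l n)
    (A := [set c | (c.1 == a k) || (c.1 == b k)])
    (P := pair_fails (a k) (b k))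
    (Q := fun F => all (fun k => pair_fails (a k) (b k) F) s)).
- rewrite exprS; apply: ler_pM; rewrite ?Pr_ge0 //; try exact: attach_prob_ge0.
    apply: Pr_pair_fails; apply/eqP => /(congr1 (@nat_of_ord l)).
    by rewrite ak bk; lia.
  by apply: IH => // k' k's; apply: ab; rewrite inE k's orbT.
- by move=> F G; apply: pair_fails_splice => i; rewrite !inE !eqxx orbT.
move=> F G; apply: eq_in_all => k' k's; apply: pair_fails_spliceC => i.
have [ak' bk'] : a k' = (2 * k')%N :> nat /\ b k' = (2 * k').+1 :> nat.
  by apply: ab; rewrite inE k's orbT.
have kk' : k' != k by apply: contraNneq ks => <-.
rewrite !inE /= -!(inj_eq (@ord_inj l)) ak bk ak' bk'.
by move: kk'; lia.
Qed.

(** The trees [2 k] and [2 k + 1] are paired; if [l] is odd the last tree is left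
    alone. *)
Lemma Pr_no_theta_root :
  P (fun F => ~~ theta depth.+1 (dag F) ord0) <= (3 / 2 ^+ u) ^+ l./2.
Proof.
have [l1|l1] := leqP l 1.
  have -> : l./2 = 0%N by case: (l) l1 => [|[]].
  by apply: Pr_le1; [apply: attach_prob_ge0 | apply: attach_prob_sum1].
pose j0 : 'I_l := Ordinal (ltnW l1).
have jK k : (k < l)%N -> (insubd j0 k : 'I_l) = k :> nat.
  by move=> kl; rewrite val_insubd kl.
apply: (@le_trans _ _ (P (fun F => all (fun k =>
   pair_fails (insubd j0 (2 * k)%N) (insubd j0 (2 * k).+1) F) (iota 0 l./2)))).
  apply: Pr_le_valid => F vF nt; apply/allP => k _; apply: contraR nt.
  exact: pair_fails_theta.
rewrite -[X in _ <= _ ^+ X](size_iota 0); apply: Pr_pairs_fail; last exact: iota_uniq.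
move=> k; rewrite mem_iota add0n => kl; rewrite !jK //; first by lia.
by have := odd_double_half l; lia.
Qed.

End RootThetaProbability.

(** * Choice of the parameters *)

Section ConfidenceSizes.
Variable R : realType.

Lemma dag_confidence (l u K : nat) (eps : R) :
    (0 < l)%N -> 0 < eps -> (2 * 2 ^ (8 * u) <= K)%N ->
    (3 / 2 ^+ u) ^+ l./2 <= eps / 2 ->
    2 * (3 * (depth u).+2%:R ^+ 3 * (8 * l%:R) ^+ (3 * (depth u).+1)) <= eps * K%:R ->
  confidence_size (@recursive_dag_pmf R l) eps K.
Proof.
move=> l0 eps0 uK failK countK.
have K0 : (0 < K)%N by apply: leq_trans uK; rewrite muln_gt0 expn_gt0.
apply: (confidence_of_property (Q := theta (depth u).+1) _ _ _ eps0 K0 countK).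
- by move=> n H; apply: recursive_dag_pmf_ge0.
- by move=> n; apply: recursive_dag_pmf_sum1.
- exact: theta_label_invariant.
- move=> n Kn; apply: le_trans failK.
  rewrite (sum_recursive_dag_pmf R l (fun H => ~~ theta (depth u).+1 H ord0)).
  apply: Pr_no_theta_root; apply: leq_trans (leq_trans uK Kn).
  by have : (0 < 2 ^ (8 * u))%N; [rewrite expn_gt0 | lia].
move=> n _; apply: le_trans (Pr_theta_sum R _ _ l0).
apply: ler_sum => v _.
by rewrite (sum_recursive_dag_pmf R l (fun H => theta (depth u).+1 H v)).
Qed.

Lemma confidence_size_mono (mu : forall n, sgraph n.+1 -> R) eps eps' K :
  eps <= eps' -> confidence_size mu eps K -> confidence_size mu eps' K.
Proof.
move=> le [K0 h]; split=> // n; have [S [S1 S2 S3]] := h n.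
by exists S; split=> //; apply: le_trans S3; rewrite lerB.
Qed.

(** From 1 - x <= exp (- x) at x = 1/2. It compares powers of 2 and exponentials
    in the convenient direction, without numerical values of ln 2. *)
Lemma expR_half_le2 : expR (2^-1) <= 2 :> R.
Proof.
have h := @expR_ge1Dx R (- 2^-1).
rewrite -[expR _]invrK -expRN invf_ple ?posrE ?expR_gt0 //.
by apply: le_trans h; lra.
Qed.

Lemma expR_le_exp2 k : expR (k%:R / 2) <= 2 ^+ k :> R.
Proof. by rewrite expRM_natl lerXn2r ?nnegrE ?expR_ge0 // expR_half_le2. Qed.

Lemma expR1_le4 : expR 1 <= 4 :> R.
Proof.
have := expR_le_exp2 2; rewrite divff ?pnatr_eq0 // => h; apply: le_trans h _.
by rewrite -natrX.
Qed.

Definition size_bound l (eps : R) : R :=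
  8 / eps * (ln (1 / eps)) `^ (900 / l%:R * ln (1 / eps)).

(** The set has order [eps^-3] elements, whereas the power of [L = ln (1 / eps)]
    in the bound exceeds [exp (4 L) = eps^-4] because [L >= 16 >= e]. *)
Lemma tree_confidence_bound (eps : R) : 0 < eps <= expR (- 16) ->
  exists K, confidence_size (@recursive_dag_pmf R 1) eps K /\
    K%:R <= size_bound 1 eps.
Proof.
case/andP=> eps0 epsS; rewrite /size_bound !div1r divr1.
have e0 : 0 < eps^-1 by rewrite invr_gt0.
have Le : expR (ln eps^-1) = eps^-1 by rewrite lnK ?posrE.
set L := ln eps^-1 in Le *.
have L16 : 16 <= L.
  by rewrite -ler_expR Le -[expR 16]invrK -expRN lef_pV2 ?posrE ?expR_gt0.
have e17 : 17 <= eps^-1 by rewrite -Le; apply: le_trans (expR_ge1Dx _); lra.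
pose D := (Num.truncn (4 / eps)).+1.
pose K := (Num.truncn (8 * D%:R ^+ 2 / eps)).+1.
have De : 4 / eps <= D%:R by apply/ltW/truncnS_gt.
have De' : D%:R <= 5 / eps.
  rewrite /D -(natr1 (Num.truncn _)).
  have : (Num.truncn (4 / eps))%:R <= 4 / eps.
    by rewrite truncn_le mulr_ge0 // ltW.
  by move: e17; set T := (Num.truncn _)%:R; set x := eps^-1; lra.
have K8 : 8 * D%:R ^+ 2 / eps <= K%:R by apply/ltW/truncnS_gt.
have K8' : K%:R <= 8 * D%:R ^+ 2 / eps + 1.
  rewrite /K -(natr1 (Num.truncn _)) lerD2r truncn_le.
  by rewrite !mulr_ge0 ?exprn_ge0 // ltW.
exists K; split.
  apply: (@tree_confidence R D) => //.
  by rewrite [leRHS]mulrC -ler_pdivrMr.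
have B4 : eps^-1 ^+ 4 <= L `^ (900 * L).
  rewrite -Le -expRM_natl.
  apply: (@le_trans _ _ (expR 1 `^ (900 * L))).
    by rewrite -expRM ler_expR mul1r; lra.
  apply: ge0_ler_powR; rewrite ?nnegrE ?expR_ge0 //; [lra|lra|].
  by apply: (le_trans expR1_le4); lra.
apply: (le_trans K8'); apply: (@le_trans _ _ (8 * eps^-1 * eps^-1 ^+ 4)); last first.
  by rewrite ler_wpM2l // mulr_ge0 // ltW.
have D2 : D%:R ^+ 2 <= 25 * eps^-1 ^+ 2.
  apply: (@le_trans _ _ ((5 / eps) ^+ 2)).
    by rewrite lerXn2r ?nnegrE // mulr_ge0 // ltW.
  by rewrite exprMn -natrX.
move: D2 e17; set x := eps^-1; set d := D%:R ^+ 2 => D2 e17.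
have x2 : 289 <= x ^+ 2 by nra.
apply: (@le_trans _ _ (201 * x ^+ 2 * x)).
  have : d * x <= 25 * x ^+ 2 * x by rewrite ler_wpM2r // ltW.
  nra.
rewrite (_ : 8 * x * x ^+ 4 = 8 * x ^+ 2 * (x ^+ 2 * x)); last by ring.
by rewrite -mulrA ler_wpM2r ?mulr_ge0 ?sqr_ge0 ?ltW //; lra.
Qed.

(** With [L = ln (1 / eps)] and [y = L / l], the parameter [u = v + 2] with [v]
    close to [12 y] makes [2 ^ (v * (l / 2))] at least [exp (2 L)], because
    [l <= 3 * (l / 2)] and [2 >= exp (1 / 2)]. The walks have length
    [t <= 18 u <= 234 y] and [8 l <= L / 2], so that the expected number of
    vertices is at most [3 * L ^ (54 u)], and [54 u <= 702 y]. *)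
Lemma dag_confidence_bound l (eps : R) : (1 < l)%N ->
    0 < eps <= expR (- (16 * l%:R)) ->
  exists K, confidence_size (@recursive_dag_pmf R l) eps K /\
    K%:R <= size_bound l eps.
Proof.
move=> l1; case/andP=> eps0 epsS; rewrite /size_bound !div1r.
have e0 : 0 < eps^-1 by rewrite invr_gt0.
have Le : expR (ln eps^-1) = eps^-1 by rewrite lnK ?posrE.
set L := ln eps^-1 in Le *.
have L16 : 16 * l%:R <= L.
  by rewrite -ler_expR Le -[expR _]invrK -expRN lef_pV2 ?posrE ?expR_gt0.
have l2 : 2 <= l%:R :> R by rewrite (ler_nat _ 2).
have l0 : 0 < l%:R :> R by lra.
pose y := L / l%:R; have y16 : 16 <= y by rewrite ler_pdivlMr.
have yE : y * l%:R = L by rewrite divfK // gt_eqF.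
have h3 : (l <= 3 * l./2)%N by have := odd_double_half l; lia.
have [v /andP[v12 v13]] : exists v : nat, 12 * y <= v%:R <= 12 * y + 1.
  exists (Num.truncn (12 * y)).+1; rewrite ltW ?truncnS_gt //=.
  by rewrite -(natr1 (Num.truncn _)) lerD2r truncn_le mulr_ge0 //; lra.
have [u uE] : exists u, u = v.+2 by exists v.+2.
have u13 : u%:R <= 13 * y by rewrite uE -addn2 natrD; lra.
have [t tE] : exists t, t = (depth u).+1 by exists (depth u).+1.
have u3 : (3 <= u)%N by rewrite -(ler_nat R) uE -addn2 natrD; lra.
have tu : (t <= 18 * u)%N by rewrite tE /depth; move: u3; clear; lia.
have u54 : ((8 * u).+1 <= 54 * u)%N by move: u3; clear; lia.
have L1 : 1 <= L by lra.
have eps_ge1 : 1 <= eps^-1 by rewrite -Le; apply: le_trans (expR_ge1Dx _); lra.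
have fails : (3 / 2 ^+ u) ^+ l./2 <= eps / 2.
  apply: (@le_trans _ _ (((2 ^+ v)^-1) ^+ l./2)).
    rewrite lerXn2r ?nnegrE ?divr_ge0 ?invr_ge0 ?exprn_ge0 //.
    have -> : 2 ^+ u = 4 * 2 ^+ v :> R.
      by rewrite uE -(addn2 v) exprD mulrC -natrX.
    by rewrite invfM mulrA ler_piMl ?invr_ge0 ?exprn_ge0 //; lra.
  rewrite exprVn -exprM -[eps]invrK -invfM lef_pV2 ?posrE ?exprn_gt0 ?mulr_gt0 //.
  apply: le_trans (expR_le_exp2 _); rewrite -Le.
  apply: (@le_trans _ _ (expR (2 * L))).
    rewrite mulr_natl mulr2n expRD.
    by rewrite ler_wpM2l ?expR_ge0 //; apply: le_trans (expR_ge1Dx _); lra.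
  rewrite ler_expR natrM.
  have : l%:R <= 3 * l./2%:R :> R by rewrite -natrM ler_nat.
  have : 12 * y * l./2%:R <= v%:R * l./2%:R by rewrite ler_wpM2r.
  rewrite -yE; have : 0 <= y by lra.
  by move: (l./2%:R) => h; nra.
have [M ME] : exists M : R, M = 3 * t.+1%:R ^+ 3 * (8 * l%:R) ^+ (3 * t) by eexists.
have M0 : 0 <= M by rewrite ME mulr_ge0 ?exprn_ge0 ?mulr_ge0 ?exprn_ge0.
exists ((Num.truncn (2 * M / eps)).+1 + 2 * 2 ^ (8 * u))%N; split.
  apply: (dag_confidence (u := u)) => //; first exact: ltnW.
    exact: leq_addl.
  rewrite -tE -ME [leRHS]mulrC -ler_pdivrMr //.
  by apply: (le_trans (ltW (truncnS_gt _))); rewrite ler_nat leq_addr.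
have B0 : L ^+ (54 * u) <= L `^ (900 / l%:R * L).
  rewrite -powR_mulrn; last by lra.
  rewrite ler_powR // mulrAC -mulrA -/y natrM; lra.
have B1 : 1 <= L ^+ (54 * u) by rewrite exprn_ege1.
have ML : M <= 3 * L ^+ (54 * u).
  rewrite ME -mulrA ler_wpM2l //.
  apply: (@le_trans _ _ ((16 * l%:R) ^+ (3 * t))).
    rewrite (_ : 16 * l%:R = 2 * (8 * l%:R)); last by ring.
    rewrite [leRHS]exprMn ler_wpM2r ?exprn_ge0 ?mulr_ge0 //.
    by rewrite -!natrX ler_nat mulnC expnM leq_exp2r // ltn_expl.
  apply: (@le_trans _ _ (L ^+ (3 * t))).
    by rewrite lerXn2r ?nnegrE ?mulr_ge0 //; lra.
  by rewrite ler_weXn2l // -[54%N]/(3 * 18)%N -mulnA leq_mul2l.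
have uL : (2 * 2 ^ (8 * u))%:R <= L ^+ (54 * u).
  rewrite -expnS natrX; apply: (@le_trans _ _ (2 ^+ (54 * u))).
    by apply: ler_weXn2l u54; rewrite ler1n.
  by rewrite lerXn2r ?nnegrE //; lra.
apply: (@le_trans _ _ (8 / eps * L ^+ (54 * u))); last first.
  by rewrite ler_wpM2l // mulr_ge0 // ltW.
have T : (Num.truncn (2 * M / eps))%:R <= 2 * M / eps.
  by rewrite truncn_le !mulr_ge0 // ltW.
have MLe : 2 * M / eps <= 6 * (L ^+ (54 * u) * eps^-1).
  rewrite -mulrA (_ : 6 * _ = 2 * (3 * L ^+ (54 * u) * eps^-1)); last by ring.
  by rewrite ler_wpM2l // ler_wpM2r // ltW.
have Leps : L ^+ (54 * u) <= L ^+ (54 * u) * eps^-1.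
  by rewrite ler_peMr // (le_trans _ B1).
rewrite natrD -(natr1 (Num.truncn _)) -[leRHS]mulrA [eps^-1 * _]mulrC.
move: T MLe uL B1 Leps; set a := (Num.truncn _)%:R; set b := (2 * _)%:R.
by set B := L ^+ _; set c := 2 * M / eps; set d := B / eps; lra.
Qed.

End ConfidenceSizes.

(** * The theorem *)

Theorem theorem1 (R : realType) :
  exists c0 c1 c2 : R,
    [/\ 0 < c0, 0 < c1, 0 < c2 &
      forall l : nat, (0 < l)%N ->
        root_estimation_possible (@recursive_dag_pmf R l) /\
        exists K : R -> nat,
          (forall eps : R, 0 < eps < 1 ->
             confidence_size (@recursive_dag_pmf R l) eps (K eps)) /\
          (forall eps : R, 0 < eps <= expR (- (c2 * l%:R)) ->
             (K eps)%:R <=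
               c0 / eps * (ln (1 / eps)) `^ (c1 / l%:R * ln (1 / eps)))].
Proof.
exists 8, 900, 16; split=> // l l0.
have small eps : 0 < eps <= expR (- (16 * l%:R)) ->
    exists K, confidence_size (@recursive_dag_pmf R l) eps K /\
      K%:R <= size_bound l eps.
  have [l1|l1] := leqP l 1; last exact: dag_confidence_bound.
  have -> : l = 1%N by lia.
  by rewrite mulr1; apply: tree_confidence_bound.
(* Only small eps are treated above; larger ones inherit the set of the largest
   small one. *)
pose trunc eps : R := Num.min eps (expR (- (16 * l%:R))).
have [K KP] : {K : R -> nat & forall eps, 0 < eps ->
    confidence_size (@recursive_dag_pmf R l) (trunc eps) (K eps) /\
    (K eps)%:R <= size_bound l (trunc eps)}.
  apply: (choice (P := fun eps k => 0 < eps ->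
    confidence_size (@recursive_dag_pmf R l) (trunc eps) k /\
    k%:R <= size_bound l (trunc eps))) => eps.
  have [eps0|_] := ltP 0 eps; last by exists 0%N.
  have [|k kP] := small (trunc eps); last by exists k.
  by rewrite /trunc lt_min eps0 expR_gt0 ge_min lexx orbT.
have Kconf eps : 0 < eps < 1 ->
    confidence_size (@recursive_dag_pmf R l) eps (K eps).
  case/andP=> eps0 _; have [conf _] := KP eps eps0.
  by apply: confidence_size_mono conf; rewrite ge_min lexx.
split; first by move=> eps epsP; exists (K eps); apply: Kconf.
exists K; split=> // eps /andP[eps0 epsS]; have [_] := KP eps eps0.
by rewrite /trunc min_l.
Qed.
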